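(* There is a universal constant $c>0$ such that the following holds for every $n\ge 1$. Let $\mu$ be the standard Gaussian measure on $\mathbb{R}$ and endow $\mathbb{R}^n$ with the product measure $\mu^{\otimes n}$. For any Borel-measurable set $A\subset\mathbb{R}^n$ with $\mu^{\otimes n}(A)=t$ there exists $1\le i\le n$ such that $$I_i^{\mathcal G}(A)\ge c\,t(1-t)\,\frac{\sqrt{\log n}}{n}.$$
   Context: Geometric influence: for a probability measure $\nu$ on $\mathbb{R}$ and a measurable $S\subseteq\mathbb{R}$, the lower Minkowski content is $\nu^+(S)=\liminf_{r\downarrow 0}\frac{\nu(S+[-r,r])-\nu(S)}{r}$ (Minkowski sum). For $A\subseteq\mathbb{R}^n$, $x\in\mathbb{R}^n$ and $1\le i\le n$, let $A_i^x=\{y\in\mathbb{R}:(x_1,\dots,x_{i-1},y,x_{i+1},\dots,x_n)\in A\}$. The geometric influence of the $i$th coordinate on $A$ with respect to $\nu^{\otimes n}$ is $I_i^{\mathcal G}(A)=\mathbb{E}_{x\sim\nu^{\otimes n}}[\nu^+(A_i^x)]\in[0,\infty]$. Here $\nu=\mu$. *)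

(* Defs.v *)
From HB Require Import structures.
From mathcomp Require Import all_boot all_order all_algebra.
From mathcomp Require Import all_classical all_reals all_analysis.

Set Implicit Arguments.
Unset Strict Implicit.
Unset Printing Implicit Defensive.
Import Order.TTheory GRing.Theory Num.Theory.
Import numFieldNormedType.Exports.
Local Open Scope classical_set_scope.
Local Open Scope ring_scope.
Local Open Scope ereal_scope.

Section power_prob.
Context d (T : measurableType d) (R : realType).

Definition tcons n (x : T * n.-tuple T) : n.+1.-tuple T :=
  [the n.+1.-tuple T of x.1 :: x.2].

Lemma measurable_tcons n : measurable_fun [set: T * n.-tuple T] (@tcons n).
Proof. exact: measurable_cons. Qed.

HB.instance Definition _ n :=
  isMeasurableFun.Build _ _ _ _ (@tcons n) (@measurable_tcons n).

(* The n-fold product of P on n.-tuple T, obtained by transporting the binary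
   products P \x (P \x ...) along (x, t) |-> x :: t. *)
Fixpoint power_prob (P : probability T R) n : probability (n.-tuple T) R :=
  match n with
  | 0 => \d_[tuple]
  | m.+1 => distribution (P \x power_prob P m) (@tcons m)
  end.

(* The characteristic property of the product measure. *)
Lemma power_prob_rect (P : probability T R) n (B : 'I_n -> set T) :
  (forall i, measurable (B i)) ->
  power_prob P n [set x | forall i, B i (tnth x i)] = \prod_(i < n) P (B i).
Proof.
elim: n B => [|n IHn] B mB.
  rewrite big_ord0 /= diracE mem_set//=; by case.
rewrite big_ord_recl /= /distribution /pushforward -IHn//.
have mtl :
    measurable [set x : n.-tuple T | forall i, B (lift ord0 i) (tnth x i)].
  have -> : [set x : n.-tuple T | forall i, B (lift ord0 i) (tnth x i)] =
      \bigcap_(i in [set: 'I_n]) ((tnth (T:=T))^~ i @^-1` B (lift ord0 i)).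
    apply/seteqP; split=> x /= Bx i; first by move=> _; exact: Bx.
    exact: Bx.
  apply: fin_bigcap_measurable => // i _; rewrite -[X in measurable X]setTI.
  exact: measurable_tnth.
rewrite -product_measure1E//; congr (_ _).
apply/seteqP; split=> -[x t] /=.
  move=> Bxt; split; first by have := Bxt ord0; rewrite tnth0.
  by move=> i; have := Bxt (lift ord0 i); rewrite tnthS.
move=> [Bx Bt] i; case: (unliftP ord0 i) => [j|] ->; last by rewrite tnth0.
by rewrite tnthS.
Qed.

End power_prob.

Section geometric_influence.
Context (R : realType).
Local Notation TR := (measurableTypeR R).

(* For r > 0 the Minkowski sum S + [-r, r] is a union of nondegenerate closed
   intervals, hence Borel, so nu is only applied to Borel sets if S is Borel. *)
Definition lower_minkowski_content (nu : set TR -> \bar R) (S : set TR) :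
    \bar R :=
  limf_einf (fun r : R =>
    (nu [set (s + u)%R | s in S & u in `[(- r)%R, r]] - nu S) * (r^-1)%:E) 0^'+.

Definition fiber n (A : set (n.-tuple TR)) (i : 'I_n) (x : n.-tuple TR) :
    set TR :=
  [set y | A [tuple if j == i then y else tnth x j | j < n]].

(* For Borel A the integrand is universally measurable but possibly not Borel;
   the integral of a nonnegative function is the supremum of the integrals of
   the measurable simple functions below it, i.e. the integral with respect to
   the completed measure here. *)
Definition geometric_influence (nu : probability TR R) n
    (A : set (n.-tuple TR)) (i : 'I_n) : \bar R :=
  \int[power_prob nu n]_x lower_minkowski_content nu (fiber A i x).

Definition gaussian : probability TR R := normal_prob 0%R 1%R.

End geometric_influence.

Arguments gaussian : clear implicits.

(* Main.v *)
Require Import Defs.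
From mathcomp Require Import all_boot all_order all_algebra perm.
From mathcomp Require Import all_classical all_reals all_analysis.
From mathcomp Require Import measurable_realfun ring lra zify.
Set Implicit Arguments.
Unset Strict Implicit.
Unset Printing Implicit Defensive.
Import Order.TTheory GRing.Theory Num.Theory.
Import numFieldNormedType.Exports.
Local Open Scope classical_set_scope.
Local Open Scope ring_scope.

(** Encode every Gaussian coordinate by m ~ log n fair bits: cut the line into
    m + 1 consecutive cells whose Gaussian masses are the binomial weights, and
    let kappa_e be the Gaussian law conditioned on the cell whose index is the
    number of ones of e. If G(eps) is the probability of A under the product of
    the laws kappa_(eps_i), then G is a [0, 1]-valued function of n m bits with
    mean t.

    For laws P, Q on the line let c(z) be the mass of the pairs (x, y) ~ P x Q
    with z between x and y. If c <= k phi, where phi is the density of the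
    Gaussian law mu, and Q <= K mu for some K, then P(S) Q(S^c) <= 2 k mu^+(S),
    because a pair with x in S and y outside the r-neighbourhood of S has between
    x and y a set of length r contained in that neighbourhood but not in S.
    Averaged over e, the crossing mass of (kappa_e, kappa_e'), where e' is e with
    one bit flipped, is 2 / m times the expectation of (sum_b +-1) 1_{X > z}, which
    is O(sqrt m phi(z)) by subgaussianity of the sum of signs. The averaged
    crossing mass of (kappa_e, kappa_e) is at most twice as large.

    Hence every bit of coordinate i has influence O(I_i / sqrt m) on G, and an
    Efron-Stein argument gives E[G (1 - G)] = O(sum_i I_i / sqrt m). If all I_i
    were below c t (1 - t) sqrt(log n) / n, the Kahn-Kalai-Linial argument
    (hypercontractivity for the low Fourier levels of G, total influence for the
    high ones) would make Var G small as well, contradicting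
    t (1 - t) = Var G + E[G (1 - G)]. *)

(** * Influences on the discrete cube *)

Section mean.
Context {R : realFieldType} {X : finType}.
Implicit Types f g : X -> R.

Definition mean f : R := (\sum_x f x) / #|X|%:R.

Lemma eq_mean f g : f =1 g -> mean f = mean g.
Proof. by move=> fg; congr (_ / _); apply: eq_bigr => x _. Qed.

Lemma meanD f g : mean (fun x => f x + g x) = mean f + mean g.
Proof. by rewrite /mean big_split/= mulrDl. Qed.

Lemma meanN f : mean (fun x => - f x) = - mean f.
Proof. by rewrite /mean sumrN mulNr. Qed.

Lemma meanZ k f : mean (fun x => k * f x) = k * mean f.
Proof. by rewrite /mean -mulr_sumr mulrA. Qed.

Lemma mean_sum (J : finType) (P : pred J) (F : J -> X -> R) :
  mean (fun x => \sum_(j | P j) F j x) = \sum_(j | P j) mean (F j).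
Proof. by rewrite /mean exchange_big/= mulr_suml. Qed.

Lemma le_mean f g : (forall x, f x <= g x) -> mean f <= mean g.
Proof.
by move=> fg; rewrite ler_wpM2r ?invr_ge0//; apply: ler_sum => x _.
Qed.

Lemma mean_ge0 f : (forall x, 0 <= f x) -> 0 <= mean f.
Proof. by move=> f0; rewrite divr_ge0// sumr_ge0. Qed.

Lemma mean_reindex (h : X -> X) f : bijective h ->
  mean (fun x => f (h x)) = mean f.
Proof.
by move=> bh; rewrite /mean [in RHS](reindex h)//=; exact: onW_bij.
Qed.

(** The mean of w (s f + t g)^2 is a nonnegative quadratic form in (s, t), and its value at (a, - b)
    is a (c a - b^2). *)
Lemma mean_weighted_cauchy_schwarz (w f g : X -> R) : (forall x, 0 <= w x) ->
  mean (fun x => w x * (f x * g x)) ^+ 2 <=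
  mean (fun x => w x * f x ^+ 2) * mean (fun x => w x * g x ^+ 2).
Proof.
move=> w0.
set a := mean (fun x => w x * g x ^+ 2).
set b := mean (fun x => w x * (f x * g x)).
set c := mean (fun x => w x * f x ^+ 2).
have key s t : 0 <= s ^+ 2 * c + 2 * s * t * b + t ^+ 2 * a.
  have : 0 <= mean (fun x => w x * (s * f x + t * g x) ^+ 2).
    by apply: mean_ge0 => x; rewrite mulr_ge0// sqr_ge0.
  rewrite (@eq_mean _ (fun x => s ^+ 2 * (w x * f x ^+ 2) +
     (2 * s * t * (w x * (f x * g x)) + t ^+ 2 * (w x * g x ^+ 2)))); last first.
    by move=> x; ring.
  by rewrite !meanD !meanZ addrA.
have a0 : 0 <= a by apply: mean_ge0 => x; rewrite mulr_ge0// sqr_ge0.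
have [a_eq0|a_neq0] := eqVneq a 0.
  have c0 : 0 <= c by apply: mean_ge0 => x; rewrite mulr_ge0// sqr_ge0.
  have [->|b0] := eqVneq b 0; first by rewrite expr0n mulr_ge0.
  (* With a = 0 and b nonzero, this choice of t turns the form into - c - 2 < 0. *)
  have := key 1 (- (c + 1) / b); rewrite a_eq0 mulr0 addr0 expr1n.
  by rewrite mulr1 mul1r -mulrA divfK//; lra.
have ap : 0 < a by rewrite lt_neqAle eq_sym a_neq0.
have := key a (- b).
rewrite (_ : _ + _ = a * (c * a - b ^+ 2)); last by ring.
by rewrite pmulr_rge0// subr_ge0.
Qed.

Lemma mean_cauchy_schwarz f g :
  mean (fun x => f x * g x) ^+ 2 <=
  mean (fun x => f x ^+ 2) * mean (fun x => g x ^+ 2).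
Proof.
have := @mean_weighted_cauchy_schwarz (fun=> 1) f g (fun=> ler01).
have mul1 h : mean (fun x => 1 * h x) = mean h by apply: eq_mean => x; rewrite mul1r.
by rewrite !mul1.
Qed.

End mean.

(** * Fourier analysis on an abstract cube whose bits are given by flips and signs *)

Section cube.
Context {R : realFieldType} {X I : finType}.
Context (flip : I -> X -> X) (sg : I -> X -> R).
Hypothesis flipK : forall i, involutive (flip i).
Hypothesis sg_sqr : forall i x, sg i x ^+ 2 = 1.
Hypothesis sg_flip : forall i x, sg i (flip i x) = - sg i x.
Hypothesis sg_flipN : forall i j x, i != j -> sg j (flip i x) = sg j x.
Hypothesis sg_inj : forall x y, (forall i, sg i x = sg i y) -> x = y.
Hypothesis cardX : #|X| = (2 ^ #|I|)%N.

Let cardX_neq0 : #|X|%:R != 0 :> R.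
Proof. by rewrite cardX natrX expf_neq0// pnatr_eq0. Qed.

Definition walsh (S : {set I}) x := \prod_(i in S) sg i x.

Lemma walshU1 i (S : {set I}) x : i \notin S ->
  walsh (i |: S) x = sg i x * walsh S x.
Proof. by move=> iS; rewrite /walsh finset.big_setU1. Qed.

Lemma walsh_flipN i (S : {set I}) x : i \notin S ->
  walsh S (flip i x) = walsh S x.
Proof.
move=> iS; apply: eq_bigr => j jS; rewrite sg_flipN//.
by apply: contraNneq iS => ->.
Qed.

Lemma walsh_flip i (S : {set I}) x : i \in S ->
  walsh S (flip i x) = - walsh S x.
Proof.
move=> iS; rewrite -(finset.setD1K iS) !walshU1 ?finset.setD11//.
by rewrite sg_flip walsh_flipN ?finset.setD11// mulNr.
Qed.

Lemma walsh_sqr S x : walsh S x ^+ 2 = 1.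
Proof. by rewrite /walsh -prodrXl big1. Qed.

Lemma mean_flip_odd i (f : X -> R) : (forall x, f (flip i x) = - f x) ->
  mean f = 0.
Proof.
move=> fN; have : mean (fun x => f (flip i x)) = mean f.
  by apply: mean_reindex; exact: (inv_bij (flipK i)).
rewrite (eq_mean fN) meanN; lra.
Qed.

Lemma mean_cst (k : R) : mean (fun _ : X => k) = k.
Proof. by rewrite /mean sumr_const -(mulr_natr k) mulfK. Qed.

(** For distinct S and T, an index in their symmetric difference gives a flip under which the
    product is odd, so its mean vanishes. *)
Lemma walsh_ortho (S T : {set I}) :
  mean (fun x => walsh S x * walsh T x) = (S == T)%:R.
Proof.
have [->|ST] := eqVneq S T.
  rewrite (@eq_mean _ _ _ (fun=> 1)) ?mean_cst// => x.
  by rewrite -expr2 walsh_sqr.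
have [i iST] : exists i, (i \in S) != (i \in T).
  apply/existsP; apply: contraNT ST; rewrite negb_exists => /forallP ST.
  by apply/eqP/finset.setP => i; apply/eqP; rewrite -[_ == _]negbK ST.
apply: (@mean_flip_odd i) => x.
case: (boolP (i \in S)) (boolP (i \in T)) iST => [iS|iS] [iT|iT] // _.
  by rewrite walsh_flip// walsh_flipN// mulNr.
by rewrite walsh_flipN// walsh_flip// mulrN.
Qed.

Lemma mean_walsh_mul (P Q : pred {set I}) (a b : {set I} -> R) :
  mean (fun x => (\sum_(S | P S) a S * walsh S x) *
                 (\sum_(S | Q S) b S * walsh S x)) =
  \sum_(S | P S && Q S) a S * b S.
Proof.
rewrite (@eq_mean _ _ _ (fun x => \sum_(S | P S) \sum_(T | Q T)
   (a S * b T) * (walsh S x * walsh T x))); last first.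
  move=> x; rewrite mulr_suml; apply: eq_bigr => S _.
  by rewrite mulr_sumr; apply: eq_bigr => T _; rewrite mulrACA.
rewrite mean_sum big_mkcondr; apply: eq_bigr => S _.
rewrite mean_sum big_mkcond (bigD1 S)//= big1 ?addr0.
  by rewrite meanZ walsh_ortho eqxx mulr1.
move=> T TS; case: ifP => // _.
by rewrite meanZ walsh_ortho eq_sym (negPf TS) mulr0.
Qed.

Definition fourier (f : X -> R) S := mean (fun x => f x * walsh S x).

(** The kernel, the sum over S of [walsh S y * walsh S x], factors as the product over i of (1 +
    [sg i y * sg i x]). It equals |X| for y = x; otherwise some sign differs and kills a factor. *)
Lemma fourier_inversion f x : f x = \sum_S fourier f S * walsh S x.
Proof.
have sumw y : \sum_S walsh S y * walsh S x = (y == x)%:R * #|X|%:R.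
  have -> : \sum_S walsh S y * walsh S x = \prod_i (sg i y * sg i x + 1).
    rewrite bigA_distr; apply: eq_bigr => S _.
    rewrite /walsh -big_split/= [LHS]big_mkcond/=.
    by apply: eq_bigr.
  have [->|yx] := eqVneq y x.
    under eq_bigr do rewrite -expr2 sg_sqr -[1 + 1]/(2%:R).
    by rewrite prodr_const cardX natrX mul1r.
  rewrite mul0r; apply/eqP; rewrite prodf_seq_eq0; apply/hasP.
  have [i yxi] : exists i, sg i y != sg i x.
    apply/existsP; apply: contraNT yx; rewrite negb_exists => /forallP yx.
    by apply/eqP/sg_inj => i; apply/eqP; rewrite -[_ == _]negbK yx.
  exists i; first exact: mem_index_enum.
  rewrite /=; have := sg_sqr i x; have /eqP := sg_sqr i y.
  rewrite sqrf_eq1 => /orP[] /eqP yE; rewrite yE in yxi *;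
  move=> /eqP; rewrite sqrf_eq1 => /orP[] /eqP xE; rewrite xE in yxi *;
  rewrite ?eqxx// in yxi *.
    by rewrite mulrN1 addNr.
  by rewrite mulN1r addNr.
transitivity (mean (fun y => f y * ((y == x)%:R * #|X|%:R))).
  rewrite /mean (bigD1 x)//= big1 ?addr0 ?eqxx ?mul1r ?mulfK//.
  by move=> y /negPf ->; rewrite mul0r mulr0.
rewrite (@eq_mean _ _ _ (fun y => \sum_S walsh S x * (f y * walsh S y))).
  by rewrite mean_sum; apply: eq_bigr => S _; rewrite meanZ mulrC.
move=> y; rewrite -sumw mulr_sumr; apply: eq_bigr => S _; ring.
Qed.

Lemma sum_subsetsU1 (V : nmodType) i (J : {set I}) (F : {set I} -> V) :
  i \notin J ->
  \sum_(S : {set I} | S \subset i |: J) F S =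
  \sum_(S : {set I} | S \subset J) F S +
  \sum_(S : {set I} | S \subset J) F (i |: S).
Proof.
move=> iJ; rewrite (bigID (fun S : {set I} => i \notin S))/=; congr (_ + _).
  apply: eq_bigl => S; apply/andP/idP => [[SJ iS]|SJ].
    apply/fintype.subsetP => j jS; have := fintype.subsetP SJ _ jS.
    by rewrite finset.in_setU1 => /orP[/eqP ji|//]; rewrite -ji jS in iS.
  split; first exact: (fintype.subset_trans SJ (finset.subsetUr _ _)).
  by apply: contra iJ => iS; exact: (fintype.subsetP SJ).
rewrite (reindex_onto (fun S => i |: S) (fun S => S :\ i))/=; last first.
  by move=> S /andP[_]; rewrite negbK => iS; rewrite finset.setD1K.
apply: eq_bigl => S; rewrite finset.setU11/= andbT.
apply/andP/idP => [[SJ /eqP <-]|SJ].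
  apply/fintype.subsetP => j; rewrite finset.in_setD1 => /andP[ji jS].
  by have := fintype.subsetP SJ _ jS; rewrite finset.in_setU1 (negPf ji).
have iS : i \notin S by apply: contra iJ => iS; exact: (fintype.subsetP SJ).
by rewrite finset.setUS// finset.setU1K.
Qed.

(** The Bonami inequality from L^2 to L^4, by induction on J. Removing i splits the polynomial into
    q + [sg i] r with q and r blind to bit i; the fourth moment is at most A^2 + 6 A B + B^2 <= (A +
    3 B)^2, and this 3 is the weight that each index adds in [3 ^+ #|S|]. *)
Lemma hypercontractive (J : {set I}) (c : {set I} -> R) :
  mean (fun x => (\sum_(S : {set I} | S \subset J) c S * walsh S x) ^+ 4) <=
  (\sum_(S : {set I} | S \subset J) 3 ^+ #|S| * c S ^+ 2) ^+ 2.
Proof.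
have [k] := ubnP #|J|; elim: k => // k IH in J c *; rewrite ltnS => Jk.
have [->|/finset.set0Pn[i iJ]] := eqVneq J finset.set0.
  have sub0 (F : {set I} -> R) :
      \sum_(S : {set I} | S \subset finset.set0) F S = F finset.set0.
    by rewrite (eq_bigl _ _ (fun S => finset.subset0 S)) big_pred1_eq.
  rewrite sub0 finset.cards0 expr0 mul1r (@eq_mean _ _ _ (fun=> c finset.set0 ^+ 4)).
    by rewrite mean_cst -exprM.
  by move=> x; rewrite sub0 /walsh finset.big_set0 mulr1.
have J1k : (#|J :\ i| < k)%N by rewrite (finset.cardsD1 i J) iJ in Jk.
rewrite -(finset.setD1K iJ); set J' := J :\ i in J1k *.
have iJ' : i \notin J' by rewrite finset.setD11.
have iS (S : {set I}) : S \subset J' -> i \notin S.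
  by move=> SJ; apply: contra iJ' => iS; exact: (fintype.subsetP SJ).
set c' := fun S => c (i |: S).
set q := fun x => \sum_(S : {set I} | S \subset J') c S * walsh S x.
set r := fun x => \sum_(S : {set I} | S \subset J') c' S * walsh S x.
set A := \sum_(S : {set I} | S \subset J') 3 ^+ #|S| * c S ^+ 2.
set B := \sum_(S : {set I} | S \subset J') 3 ^+ #|S| * c' S ^+ 2.
have qA : mean (fun x => q x ^+ 4) <= A ^+ 2 by exact: IH.
have rB : mean (fun x => r x ^+ 4) <= B ^+ 2 by exact: IH.
have A0 : 0 <= A by apply: sumr_ge0 => S _; rewrite mulr_ge0 ?sqr_ge0 ?exprn_ge0.
have B0 : 0 <= B by apply: sumr_ge0 => S _; rewrite mulr_ge0 ?sqr_ge0 ?exprn_ge0.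
have -> : \sum_(S : {set I} | S \subset i |: J') 3 ^+ #|S| * c S ^+ 2 = A + 3 * B.
  rewrite sum_subsetsU1//; congr (_ + _); rewrite mulr_sumr.
  by apply: eq_bigr => S /iS iS'; rewrite finset.cardsU1 iS' add1n exprS -mulrA.
have qf x : q (flip i x) = q x.
  by apply: eq_bigr => S /iS iS'; rewrite walsh_flipN.
have rf x : r (flip i x) = r x.
  by apply: eq_bigr => S /iS iS'; rewrite walsh_flipN.
have -> : mean (fun x =>
    (\sum_(S : {set I} | S \subset i |: J') c S * walsh S x) ^+ 4) =
    mean (fun x => q x ^+ 4) + 6 * mean (fun x => q x ^+ 2 * r x ^+ 2) +
    mean (fun x => r x ^+ 4).
  (* The terms with an odd power of the sign are odd under the flip of i and have mean 0. *)
  transitivity (mean (fun x => (q x ^+ 4 + 6 * (q x ^+ 2 * r x ^+ 2) + r x ^+ 4)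
    + sg i x * (4 * q x ^+ 3 * r x + 4 * q x * r x ^+ 3))); last first.
    rewrite meanD [X in _ + X](@mean_flip_odd i).
      by rewrite addr0 !meanD meanZ.
    by move=> x; rewrite qf rf sg_flip mulNr.
  apply: eq_mean => x; rewrite sum_subsetsU1//.
  have -> : \sum_(S : {set I} | S \subset J') c (i |: S) * walsh (i |: S) x = sg i x * r x.
    rewrite /r mulr_sumr; apply: eq_bigr => S /iS iS'.
    by rewrite walshU1// /c' mulrCA.
  rewrite -/(q x); have := sg_sqr i x; set s := sg i x => s2.
  have s3 : s ^+ 3 = s by rewrite exprSr s2 mul1r.
  have s4 : s ^+ 4 = 1 by rewrite exprSr s3 -expr2.
  transitivity (q x ^+ 4 + 4 * q x ^+ 3 * r x * s + 6 * (q x ^+ 2 * r x ^+ 2) * s ^+ 2 +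
     4 * q x * r x ^+ 3 * s ^+ 3 + r x ^+ 4 * s ^+ 4); first by ring.
  by rewrite s2 s3 s4; ring.
(* Cauchy-Schwarz reduces the mixed moment to the two fourth moments bounded by induction. *)
have qr : mean (fun x => q x ^+ 2 * r x ^+ 2) <= A * B.
  rewrite -(@ler_pXn2r _ 2)// ?nnegrE; last 2 first.
    by apply: mean_ge0 => x; apply: mulr_ge0; exact: sqr_ge0.
    exact: mulr_ge0.
  apply: (le_trans (mean_cauchy_schwarz _ _)); rewrite exprMn.
  apply: ler_pM; [| |move: qA|move: rB].
  - by apply: mean_ge0 => x; exact: sqr_ge0.
  - by apply: mean_ge0 => x; exact: sqr_ge0.
  - by apply: le_trans; apply: le_mean => x; rewrite -exprM.
  - by apply: le_trans; apply: le_mean => x; rewrite -exprM.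
nra.
Qed.

Definition half_diff (f : X -> R) i x := (f x - f (flip i x)) / 2.

(** The flip is a bijection, so it can be moved from f to the Walsh function, which it negates if i
    is in S and preserves otherwise. *)
Lemma fourier_half_diff f i S :
  fourier (half_diff f i) S = if i \in S then fourier f S else 0.
Proof.
rewrite /fourier /half_diff.
have flE : mean (fun x => f (flip i x) * walsh S x) =
           mean (fun x => f x * walsh S (flip i x)).
  rewrite -[RHS](@mean_reindex _ _ (flip i)); last exact: (inv_bij (flipK i)).
  by apply: eq_mean => x; rewrite flipK.
transitivity (2^-1 * (mean (fun x => f x * walsh S x) -
                      mean (fun x => f x * walsh S (flip i x)))).
  rewrite -flE -meanN -meanD -meanZ; apply: eq_mean => x; ring.
case: ifPn => iS.
  rewrite [X in _ - X](@eq_mean _ _ _ (fun x => - (f x * walsh S x))).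
    by rewrite meanN; field.
  by move=> x; rewrite walsh_flip// mulrN.
rewrite [X in _ - X](@eq_mean _ _ _ (fun x => f x * walsh S x)) ?subrr ?mulr0//.
by move=> x; rewrite walsh_flipN.
Qed.

Lemma parseval f : mean (fun x => f x ^+ 2) = \sum_S fourier f S ^+ 2.
Proof.
rewrite (@eq_mean _ _ _ (fun x => (\sum_S fourier f S * walsh S x) *
                               (\sum_S fourier f S * walsh S x))).
  by rewrite mean_walsh_mul; apply: eq_bigr => S _; rewrite expr2.
by move=> x; rewrite -fourier_inversion -expr2.
Qed.

Lemma variance_fourier f :
  mean (fun x => f x ^+ 2) - mean f ^+ 2 =
  \sum_(S | S != finset.set0) fourier f S ^+ 2.
Proof.
rewrite parseval (bigD1 finset.set0)//= /fourier addrAC.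
rewrite (@eq_mean _ _ _ f) ?subrr ?add0r//.
by move=> x; rewrite /walsh finset.big_set0 mulr1.
Qed.

(* As |u| <= 1, two applications of Cauchy-Schwarz replace the L^(4/3) norm. *)
Lemma low_degree_weight (u : X -> R) (d : nat) (s : R) :
  0 <= s -> (forall x, `|u x| <= 1) -> mean (fun x => `|u x|) <= s ^+ 2 ->
  \sum_(S : {set I} | (#|S| <= d)%N) fourier u S ^+ 2 <= 3 ^+ d * s ^+ 3.
Proof.
move=> s0 u1 us; set Q := (X in X <= _).
set p := fun x => \sum_(S : {set I} | (#|S| <= d)%N) fourier u S * walsh S x.
have Q0 : 0 <= Q by apply: sumr_ge0 => S _; exact: sqr_ge0.
have pQ : mean (fun x => u x * p x) = Q.
  rewrite (@eq_mean _ _ _ (fun x => (\sum_S fourier u S * walsh S x) * p x)).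
    by rewrite mean_walsh_mul; apply: eq_bigr => S _; rewrite expr2.
  by move=> x; rewrite -fourier_inversion.
have p4 : mean (fun x => p x ^+ 4) <= (3 ^+ d * Q) ^+ 2.
  pose c := fun S : {set I} => if (#|S| <= d)%N then fourier u S else 0.
  have := hypercontractive finset.setT c.
  rewrite (@eq_mean _ _ _ (fun x => p x ^+ 4)) => [h|x]; last first.
    congr (_ ^+ 4); rewrite /p [RHS]big_mkcond/=; apply: eq_big => S.
      by rewrite finset.subsetT.
    by rewrite /c; case: ifP; rewrite ?mul0r.
  apply: (le_trans h); rewrite ler_pXn2r ?nnegrE//; last 2 first.
    by apply: sumr_ge0 => S _; rewrite mulr_ge0 ?sqr_ge0 ?exprn_ge0.
    by rewrite mulr_ge0 ?exprn_ge0.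
  rewrite /Q mulr_sumr [leRHS]big_mkcond/=.
  under eq_bigl do rewrite finset.subsetT.
  apply: ler_sum => S _; rewrite /c; case: ifPn => [Sd|_].
    by rewrite ler_wpM2r ?sqr_ge0// ler_weXn2l// ler1n.
  by rewrite expr0n/= mulr0.
have u2 : mean (fun x => u x ^+ 2) <= s ^+ 2.
  apply: le_trans us; apply: le_mean => x.
  by rewrite -real_normK ?num_real// expr2 ler_piMl.
set W := mean (fun x => `|u x| * p x ^+ 2).
have W0 : 0 <= W by apply: mean_ge0 => x; rewrite mulr_ge0 ?sqr_ge0.
(* First Cauchy-Schwarz, with weight |u|: u p is the weight times sgn(u) times p. The second one,
   below, bounds W by the second moment of u and the fourth moment of p. *)
have W1 : Q ^+ 2 <= s ^+ 2 * W.
  rewrite -pQ.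
  have := @mean_weighted_cauchy_schwarz _ _ (fun x => `|u x|) (fun x => Num.sg (u x)) p
    (fun x => normr_ge0 _).
  rewrite (@eq_mean _ _ _ (fun x => u x * p x)) => [h|x]; last first.
    by rewrite mulrA [X in X * _]mulrC -numEsg.
  apply: (le_trans h); rewrite -/W ler_wpM2r//; apply: le_trans us.
  apply: le_mean => x; rewrite ler_piMr//.
  by rewrite sqr_sg; case: (_ != 0).
have W2 : W ^+ 2 <= s ^+ 2 * (3 ^+ d * Q) ^+ 2.
  apply: (le_trans (mean_cauchy_schwarz _ _)); apply: ler_pM.
  - by apply: mean_ge0 => x; rewrite sqr_ge0.
  - by apply: mean_ge0 => x; rewrite sqr_ge0.
  - by apply: le_trans u2; apply: le_mean => x; rewrite real_normK// num_real.
  - by apply: le_trans p4; apply: le_mean => x; rewrite -exprM.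
have W3 : W <= s * (3 ^+ d * Q).
  have D0 : 0 <= s * (3 ^+ d * Q) by rewrite !mulr_ge0// exprn_ge0.
  by rewrite -(@ler_pXn2r _ 2)// ?nnegrE// (exprMn 2 s).
have Q2 : Q ^+ 2 <= (3 ^+ d * s ^+ 3) * Q.
  apply: (le_trans W1); apply: (@le_trans _ _ (s ^+ 2 * (s * (3 ^+ d * Q)))).
    by rewrite ler_wpM2l// sqr_ge0.
  by rewrite le_eqVlt; apply/orP; left; apply/eqP; ring.
have [->|Qn0] := eqVneq Q 0; first by rewrite mulr_ge0 ?exprn_ge0.
by rewrite -(@ler_pM2r _ Q) -?expr2// lt_neqAle eq_sym Qn0.
Qed.

(** The Kahn-Kalai-Linial argument. Above level d, each squared coefficient is at most |S| / (d + 1)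
    times itself, and summing |S| times the squared coefficients gives the total influence. The
    levels from 1 to d are covered by the low-degree weights of the half differences. *)
Lemma variance_le_influences (f : X -> R) (d : nat) (s : R) :
  0 <= s -> (forall x, 0 <= f x <= 1) ->
  (forall i, mean (fun x => `|f x - f (flip i x)|) <= s ^+ 2) ->
  mean (fun x => f x ^+ 2) - mean f ^+ 2 <=
  #|I|%:R * (s ^+ 2 / d.+1%:R + 3 ^+ d * s ^+ 3).
Proof.
move=> s0 f01 fs.
have hd1 i x : `|half_diff f i x| <= 1.
  rewrite /half_diff normrM normfV (@ger0_norm _ 2)// ler_pdivrMr// mul1r.
  have := f01 x; have := f01 (flip i x); rewrite ler_norml; lra.
have hds i : mean (fun x => `|half_diff f i x|) <= s ^+ 2.
  apply: le_trans (fs i); apply: le_mean => x.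
  rewrite /half_diff normrM normfV (@ger0_norm _ 2)// ler_pdivrMr// mulr_natr mulr2n.
  by rewrite lerDl.
rewrite variance_fourier (bigID (fun S : {set I} => (#|S| <= d)%N))/=.
rewrite mulrDr addrC; apply: lerD.
- apply: (@le_trans _ _ (\sum_i mean (fun x => half_diff f i x ^+ 2) / d.+1%:R)).
    rewrite -mulr_suml ler_pdivlMr ?ltr0n// mulr_suml.
    under [leRHS]eq_bigr do rewrite parseval.
    rewrite exchange_big/= [leLHS]big_mkcond/=; apply: ler_sum => S _.
    under eq_bigr do rewrite fourier_half_diff.
    have -> : \sum_i (if i \in S then fourier f S else 0) ^+ 2 =
        fourier f S ^+ 2 * #|S|%:R.
      rewrite mulr_natr -sumr_const [RHS]big_mkcond/=; apply: eq_bigr => i _.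
      by case: ifP; rewrite ?expr0n.
    case: ifPn => [/andP[_]|_]; last by rewrite mulr_ge0 ?sqr_ge0.
    by rewrite -ltnNge => dS; rewrite ler_wpM2l ?sqr_ge0// ler_nat.
  rewrite mulr_natl -sumr_const; apply: ler_sum => i _.
  rewrite ler_wpM2r ?invr_ge0//; apply: le_trans (hds i); apply: le_mean => x.
  by rewrite -real_normK ?num_real// expr2 ler_piMl.
- rewrite mulr_natl -sumr_const.
  apply: (@le_trans _ _ (\sum_i \sum_(S : {set I} | (#|S| <= d)%N)
      fourier (half_diff f i) S ^+ 2)); last first.
    by apply: ler_sum => i _; exact: low_degree_weight.
  rewrite exchange_big/= big_mkcondl/= ; apply: ler_sum => S _.
  (* A nonempty S is already accounted for by the half difference along any one of its elements. *)
  case: ifPn => [/finset.set0Pn[i iS]|_]; last by apply: sumr_ge0 => i _; exact: sqr_ge0.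
  rewrite (bigD1 i)//= fourier_half_diff iS lerDl.
  by apply: sumr_ge0 => j _; exact: sqr_ge0.
Qed.

End cube.

(** * Products of probability measures *)

Section indicator_variance.
Context (R : realType) d (T : measurableType d).

(** The variance of the indicator of S. *)
Definition bvar (P : probability T R) (S : set T) : R :=
  (fine (P S) * (1 - fine (P S)))%R.

Lemma fine_prob_itv (P : probability T R) (S : set T) :
  measurable S -> (0 <= fine (P S) <= 1)%R.
Proof.
move=> mS; rewrite fine_ge0//= -lee_fin fineK ?fin_num_measure//.
exact: probability_le1.
Qed.

Lemma bvar_ge0 (P : probability T R) (S : set T) :
  measurable S -> (0 <= bvar P S)%R.
Proof.
by move=> mS; have /andP[? ?] := fine_prob_itv P mS; rewrite mulr_ge0// subr_ge0.
Qed.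

Lemma fine_probC (P : probability T R) (S : set T) :
  measurable S -> fine (P (~` S)) = (1 - fine (P S))%R.
Proof.
move=> mS; rewrite probability_setC//.
by rewrite -[P S]fineK ?fin_num_measure.
Qed.

End indicator_variance.

(** * The Efron-Stein inequality for an indicator on two factors *)

Section indicator_product.
Context d1 d2 (T1 : measurableType d1) (T2 : measurableType d2) (R : realType).
Local Open Scope ereal_scope.

Variables (P1 : probability T1 R) (P2 : probability T2 R).
Variables (B : set (T1 * T2)) (mB : measurable B).

Let m_x : measurable_fun setT (fun x => fine (P2 (xsection B x))).
Proof.
apply: (measurableT_comp (fine_measurable measurableT)).
exact: (measurable_fun_xsection P2 mB).
Qed.

Let m_y : measurable_fun setT (fun y => fine (P1 (ysection B y))).
Proof.
apply: (measurableT_comp (fine_measurable measurableT)).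
exact: (measurable_fun_ysection P1 mB).
Qed.

Let xsectionC (C : set (T1 * T2)) x : xsection (~` C) x = ~` xsection C x.
Proof.
by apply/seteqP; split=> y; rewrite /setC/= => h1;
  [move/xsectionP: h1 => h1 /xsectionP|apply/xsectionP => h2; apply: h1; apply/xsectionP].
Qed.

Let ysectionC (C : set (T1 * T2)) y : ysection (~` C) y = ~` ysection C y.
Proof.
by apply/seteqP; split=> x; rewrite /setC/= => h1;
  [move/ysectionP: h1 => h1 /ysectionP|apply/ysectionP => h2; apply: h1; apply/ysectionP].
Qed.

Lemma product_prob_xsection :
  (P1 \x P2) B = \int[P1]_x (fine (P2 (xsection B x)))%:E.
Proof.
apply: eq_integral => x _ /=; rewrite fineK// fin_num_measure//.
exact: measurable_xsection.
Qed.

Lemma product_prob_ysection :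
  (P1 \x P2) B = \int[P2]_y (fine (P1 (ysection B y)))%:E.
Proof.
transitivity ((P1 \x^ P2) B).
  apply: product_measure_unique => //= A1 A2 mA1 mA2.
  by rewrite product_measure2E.
apply: eq_integral => x _ /=; rewrite fineK// fin_num_measure//.
exact: measurable_ysection.
Qed.

(** Let K(y) and G(x) be the masses of the sections. Both average to the mass of B, so K(y) (1 -
    G(x)) integrates to the left side. Pointwise it is at most K(y) outside B and at most 1 - G(x)
    on B, and these two bounds integrate to the variances of the sections. *)
Lemma efron_stein_indic :
  (bvar (P1 \x P2) B)%:E <=
  \int[P2]_y (bvar P1 (ysection B y))%:E + \int[P1]_x (bvar P2 (xsection B x))%:E.
Proof.
set K := fun y => fine (P1 (ysection B y)).
set G := fun x => fine (P2 (xsection B x)).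
have mKy y : measurable (ysection B y) by exact: measurable_ysection.
have mGx x : measurable (xsection B x) by exact: measurable_xsection.
have K01 y : (0 <= K y <= 1)%R by exact: fine_prob_itv.
have G01 x : (0 <= G x <= 1)%R by exact: fine_prob_itv.
have K0 y : (0 <= K y)%R by case/andP: (K01 y).
have G0 x : (0 <= G x)%R by case/andP: (G01 x).
have K1 y : (0 <= 1 - K y)%R by rewrite subr_ge0; case/andP: (K01 y).
have G1 x : (0 <= 1 - G x)%R by rewrite subr_ge0; case/andP: (G01 x).
have mG1 : measurable_fun setT (fun x => (1 - G x)%R).
  by apply: measurable_funB => //.
have intG1 : \int[P1]_x (1 - G x)%:E = (1 - fine ((P1 \x P2) B))%:E.
  rewrite -fine_probC// fineK ?fin_num_measure//; last exact: measurableC.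
  apply: eq_integral => x _ /=; rewrite xsectionC -fine_probC// fineK//.
  by rewrite fin_num_measure//; exact: measurableC.
set F := fun z : T1 * T2 => (K z.2 * (1 - G z.1))%:E.
set H1 := fun z : T1 * T2 => (K z.2 * \1_(~` B) z)%:E.
set H2 := fun z : T1 * T2 => (\1_B z * (1 - G z.1))%:E.
have mK2 : measurable_fun setT (fun z : T1 * T2 => K z.2).
  exact: measurableT_comp.
have mG21 : measurable_fun setT (fun z : T1 * T2 => (1 - G z.1)%R).
  exact: (measurableT_comp mG1).
have mF : measurable_fun setT F.
  by apply/measurable_EFinP; exact: measurable_funM.
have mH1 : measurable_fun setT H1.
  apply/measurable_EFinP; apply: measurable_funM => //.
  by apply: measurable_indic; exact: measurableC.
have mH2 : measurable_fun setT H2.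
  by apply/measurable_EFinP; apply: measurable_funM => //; exact: measurable_indic.
have F0 z : 0 <= F z by rewrite lee_fin mulr_ge0.
have H10 z : 0 <= H1 z by rewrite lee_fin mulr_ge0.
have H20 z : 0 <= H2 z by rewrite lee_fin mulr_ge0.
have intF : \int[P1 \x P2]_z F z = (bvar (P1 \x P2) B)%:E.
  rewrite fubini_tonelli1// /fubini_F /=.
  have intK : \int[P2]_y (K y)%:E = (P1 \x P2) B by rewrite product_prob_ysection.
  rewrite (eq_integral (fun x => (1 - G x)%:E * (P1 \x P2) B)); last first.
    move=> x _; rewrite (eq_integral (fun y => (1 - G x)%:E * (K y)%:E)); last first.
      by move=> y _; rewrite /F/= mulrC EFinM.
    rewrite ge0_integralZl; [by rewrite intK|exact: measurableT| | |].
    - exact/measurable_EFinP.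
    - by move=> y _; rewrite lee_fin.
    - by rewrite lee_fin.
  rewrite ge0_integralZr; [|exact: measurableT| | |]; last 3 first.
  - exact/measurable_EFinP.
  - by move=> y _; rewrite lee_fin.
  - exact: measure_ge0.
  rewrite intG1 /bvar EFinM muleC fineK//.
  by apply: fin_num_measure.
have intH1 : \int[P1 \x P2]_z H1 z = \int[P2]_y (bvar P1 (ysection B y))%:E.
  rewrite fubini_tonelli2//; apply: eq_integral => y _ /=.
  rewrite /fubini_G /H1 /=; under eq_integral do rewrite EFinM.
  rewrite ge0_integralZl; [|exact: measurableT| | |]; last 3 first.
  - apply/measurable_EFinP; apply: (measurableT_comp (measurable_indic (measurableC mB))).
    exact: pair2_measurable.
  - by move=> x _; rewrite lee_fin.
  - by rewrite lee_fin.
  rewrite /bvar EFinM -fine_probC//; congr (_ * _).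
  rewrite fineK ?fin_num_measure//; last exact: measurableC.
  rewrite -ysectionC -[X in _ = P1 X]setIT -integral_indic//; last first.
    by apply: measurable_ysection; exact: measurableC.
  by apply: eq_integral => x _; rewrite !indicE mem_ysection.
have intH2 : \int[P1 \x P2]_z H2 z = \int[P1]_x (bvar P2 (xsection B x))%:E.
  rewrite fubini_tonelli1//; apply: eq_integral => x _ /=.
  rewrite /fubini_F /H2 /=; under eq_integral do rewrite EFinM.
  rewrite ge0_integralZr; [|exact: measurableT| | |]; last 3 first.
  - apply/measurable_EFinP; apply: (measurableT_comp (measurable_indic mB)).
    exact: pair1_measurable.
  - by move=> y _; rewrite lee_fin.
  - by rewrite lee_fin.
  rewrite /bvar EFinM; congr (_ * _).
  rewrite fineK ?fin_num_measure//.
  rewrite -[X in _ = P2 X]setIT -integral_indic//.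
  by apply: eq_integral => y _; rewrite !indicE mem_xsection.
rewrite -intF -intH1 -intH2 -ge0_integralD//.
apply: ge0_le_integral => //; first exact: emeasurable_funD.
move=> [x y] _; rewrite /F /H1 /H2 -EFinD lee_fin /= !indicE in_setC.
have := K01 y; have := G01 x; case: (_ \in B) => /=;
  rewrite ?mulr0 ?mulr1 ?mul0r ?mul1r ?addr0 ?add0r.
  nra.
nra.
Qed.

End indicator_product.

(** * Finite averages in the extended reals *)

Section emean.
Context (R : realType).
Local Open Scope ereal_scope.

(** The counterpart of [mean] for extended real values: nonnegative averages and integrals can then
    be exchanged without integrability conditions. *)
Definition emean (X : finType) (f : X -> \bar R) : \bar R :=
  (#|X|%:R^-1)%:E * \sum_x f x.

Let inv_card_ge0 (X : finType) : 0 <= ((#|X|%:R^-1)%:E : \bar R).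
Proof. by rewrite lee_fin invr_ge0. Qed.

Lemma EFin_mean (X : finType) (f : X -> R) :
  (mean f)%:E = emean (fun x => (f x)%:E).
Proof. by rewrite /emean /mean mulrC EFinM sumEFin. Qed.

Lemma eq_emean (X : finType) (f g : X -> \bar R) : f =1 g -> emean f = emean g.
Proof. by move=> fg; congr (_ * _); apply: eq_bigr => x _. Qed.

Lemma le_emean (X : finType) (f g : X -> \bar R) :
  (forall x, f x <= g x) -> emean f <= emean g.
Proof. by move=> fg; apply: lee_wpmul2l => //; apply: lee_sum => x _. Qed.

Lemma emean_ge0 (X : finType) (f : X -> \bar R) :
  (forall x, 0 <= f x) -> 0 <= emean f.
Proof. by move=> f0; apply: mule_ge0 => //; apply: sume_ge0. Qed.

Lemma emeanD (X : finType) (f g : X -> \bar R) :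
  (forall x, 0 <= f x) -> (forall x, 0 <= g x) ->
  emean (fun x => f x + g x) = emean f + emean g.
Proof.
by move=> f0 g0; rewrite /emean big_split/= ge0_muleDr//; apply: sume_ge0.
Qed.

Lemma exchange_emean (X Y : finType) (f : X -> Y -> \bar R) :
  (forall x y, 0 <= f x y) ->
  emean (fun x => emean (f x)) = emean (fun y => emean (f^~ y)).
Proof.
move=> f0; rewrite /emean.
rewrite -ge0_sume_distrr => [|x _]; last exact: sume_ge0.
rewrite -ge0_sume_distrr => [|x _]; last exact: sume_ge0.
by rewrite muleCA exchange_big.
Qed.

Lemma emean_tuple_cons (X : finType) n (f : n.+1.-tuple X -> \bar R) :
  (forall x, 0 <= f x) ->
  emean f = emean (fun e => emean (fun t : n.-tuple X => f [tuple of e :: t])).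
Proof.
move=> f0; rewrite /emean -ge0_sume_distrr => [|x _]; last exact: sume_ge0.
rewrite muleA -EFinM card_tuple expnS natrM invfM -card_tuple; congr (_ * _).
rewrite pair_big/=.
rewrite (reindex (fun p : X * n.-tuple X => [tuple of p.1 :: p.2]))//=.
exists (fun t => (thead t, [tuple of behead t])) => [[e t] _|t _] /=.
  by congr (_, _); apply/val_inj.
by rewrite -tuple_eta.
Qed.

Context d (T : measurableType d).

Lemma integral_emean (P : {measure set T -> \bar R}) (X : finType)
    (f : X -> T -> \bar R) :
  (forall e, measurable_fun setT (f e)) -> (forall e x, 0 <= f e x) ->
  \int[P]_x emean (fun e => f e x) = emean (fun e => \int[P]_x f e x).
Proof.
move=> mf f0; rewrite /emean ge0_integralZl//.
- by rewrite ge0_integral_sum.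
- by apply: emeasurable_sum => e.
- by move=> x _; apply: sume_ge0.
Qed.

(** The hypothesis says that m is the uniform mixture of the laws P e, hence a scaled finite sum of
    measures, against which the integral splits. *)
Lemma emean_integral (X : finType) (P : X -> probability T R)
    (m : probability T R) (g : T -> \bar R) :
  (forall S, measurable S -> emean (P^~ S) = m S) ->
  measurable_fun setT g -> (forall x, 0 <= g x) ->
  emean (fun e => \int[P e]_x g x) = \int[m]_x g x.
Proof.
move=> Pm mg g0.
have [e0|X0] := pickP {: X}; last first.
  have := Pm setT measurableT; rewrite probability_setT /emean big_pred0//.
  by rewrite mule0 => /eqP; rewrite lt_eqF.
move=> _.
pose c := NngNum (eqbRL (invr_ge0 (#|X|%:R : R)) (ler0n _ _)).
pose Q (k : nat) : {measure set T -> \bar R} := P (nth e0 (enum X) k).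
have sumE (F : probability T R -> \bar R) :
    \sum_(k < #|X|) F (P (nth e0 (enum X) k)) = \sum_e F (P e).
  rewrite (big_enum_val (fun e => F (P e)))/=.
  by apply: eq_bigr => k _; rewrite (enum_val_nth e0 k).
rewrite [RHS](eq_measure_integral (mscale c (msum Q #|X|))); last first.
  move=> S mS _; apply: etrans; first exact: (esym (Pm S mS)).
  rewrite /mscale/= /msum; congr (_ * _).
  exact: (esym (sumE (fun p => p S))).
rewrite ge0_integral_mscale// ge0_integral_measure_sum//=.
congr (_ * _); exact: (esym (sumE (fun p => \int[p]_x g x))).
Qed.

End emean.

Section real_integrals.
Context (R : realType) d (T : measurableType d).
Local Open Scope ereal_scope.

Lemma measurable_mean (X : finType)
    (f : X -> T -> R) : (forall e, measurable_fun setT (f e)) ->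
  measurable_fun setT (fun x => mean (fun e => f e x)).
Proof.
by move=> mf; apply: measurable_funM => //; apply: measurable_sum => e.
Qed.

Lemma normB_integral_le (P : probability T R) (f g : T -> R) :
  measurable_fun setT f -> measurable_fun setT g ->
  (forall x, (0 <= f x <= 1)%R) -> (forall x, (0 <= g x <= 1)%R) ->
  (`|fine (\int[P]_x (f x)%:E) - fine (\int[P]_x (g x)%:E)|%R)%:E <=
  \int[P]_x (`|f x - g x|%R)%:E.
Proof.
move=> mf mg f01 g01.
have int_f (h : T -> R) : measurable_fun setT h -> (forall x, (0 <= h x <= 1)%R) ->
    P.-integrable setT (EFin \o h).
  move=> mh h01; apply: (@le_integrable _ _ _ P _ measurableT _ (EFin \o cst 1%R)).
  - exact/measurable_EFinP.
  - by move=> x _ /=; rewrite lee_fin normr1 ger0_norm; case/andP: (h01 x).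
  - exact: finite_measure_integrable_cst.
rewrite -/(Rintegral P setT f) -/(Rintegral P setT g) -RintegralB//; try exact: int_f.
rewrite EFin_normr_Rintegral//; last first.
  exact: (integrableB measurableT (int_f f mf f01) (int_f g mg g01)).
apply: le_trans; first apply: le_abse_integral => //.
  by apply/measurable_EFinP; exact: measurable_funB.
exact: le_refl.
Qed.

End real_integrals.

(** * Fibers along a coordinate, as sections of a product *)

Section fibers.
Context (R : realType).
Local Notation TR := (measurableTypeR R).

Lemma fiber_ord0 n (A : set (n.+1.-tuple TR)) (y : TR) (x : n.-tuple TR) :
  fiber A ord0 (tcons (y, x)) = ysection (@tcons _ _ n @^-1` A) x.
Proof.
apply/seteqP; split=> z; rewrite /fiber/= => Az.
  apply/ysectionP; rewrite /preimage/=; congr A: Az.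
  apply: eq_from_tnth => i; rewrite tnth_mktuple.
  by case: (unliftP ord0 i) => [j|] ->; rewrite ?tnthS// eqxx !tnth0.
move/ysectionP : Az; rewrite /preimage/= => Az; congr A: Az.
apply: eq_from_tnth => i; rewrite tnth_mktuple.
by case: (unliftP ord0 i) => [j|] ->; rewrite ?tnthS// eqxx !tnth0.
Qed.

Lemma fiber_lift n (A : set (n.+1.-tuple TR)) j (y : TR) (x : n.-tuple TR) :
  fiber A (lift ord0 j) (tcons (y, x)) =
  fiber (xsection (@tcons _ _ n @^-1` A) y) j x.
Proof.
have E z : [tuple if i == lift ord0 j then z else tnth (tcons (y, x)) i | i < n.+1]
    = tcons (y, [tuple if i == j then z else tnth x i | i < n]).
  apply: eq_from_tnth => i; rewrite tnth_mktuple.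
  case: (unliftP ord0 i) => [k|] ->; last by rewrite !tnth0.
  by rewrite !tnthS tnth_mktuple (inj_eq (@lift_inj _ _)).
apply/seteqP; split=> z; rewrite /fiber/= E => Az; first exact/xsectionP.
by move/xsectionP : Az.
Qed.

Lemma measurable_fibers n (A : set (n.-tuple TR)) (i : 'I_n) : measurable A ->
  measurable [set p : n.-tuple TR * TR | fiber A i p.1 p.2].
Proof.
move=> mA.
pose h (p : n.-tuple TR * TR) : n.-tuple TR :=
  [tuple if j == i then p.2 else tnth p.1 j | j < n].
have mh : measurable_fun setT h.
  apply/measurable_fun_tnthP => j.
  rewrite (_ : _ \o _ = if j == i then snd else (fun p => tnth p.1 j)).
    case: ifP => // _.
    by apply: (measurableT_comp (measurable_tnth j)).
  by apply/funext => p /=; rewrite tnth_mktuple; case: ifP.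
by have := mh measurableT A mA; rewrite setTI.
Qed.

Let xsection_fibers n (A : set (n.-tuple TR)) (i : 'I_n) x :
  xsection [set p : n.-tuple TR * TR | fiber A i p.1 p.2] x = fiber A i x.
Proof. by apply/seteqP; split=> y; [move/xsectionP|move=> ?; apply/xsectionP]. Qed.

Lemma measurable_fiber n (A : set (n.-tuple TR)) (i : 'I_n) x : measurable A ->
  measurable (fiber A i x).
Proof.
by move=> mA; rewrite -xsection_fibers; apply: measurable_xsection; exact: measurable_fibers.
Qed.

Lemma measurable_prob_fiber (P : probability TR R) n (A : set (n.-tuple TR))
  (i : 'I_n) : measurable A ->
  measurable_fun setT (fun x => fine (P (fiber A i x))).
Proof.
move=> mA; apply: (measurableT_comp (fine_measurable measurableT)).
under eq_fun do rewrite -xsection_fibers.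
by apply: measurable_fun_xsection; exact: measurable_fibers.
Qed.

End fibers.

(** * Products of laws chosen at random, coordinate by coordinate *)

Section randomized_product.
Context (R : realType) (E : finType).
Local Notation TR := (measurableTypeR R).
Variables (kappa : E -> probability TR R) (mu : probability TR R).
Hypothesis kappa_mean : forall S, measurable S -> emean (kappa^~ S) = mu S.
Local Open Scope ereal_scope.

(** The law of independent coordinates, the i-th one distributed as [kappa (tnth e i)]. The
    recursion mirrors [power_prob], so that both peel off the first coordinate in the same way. *)
Fixpoint prod_prob n : n.-tuple E -> probability (n.-tuple TR) R :=
  match n with
  | 0 => fun=> \d_[tuple]
  | m.+1 => fun e => distribution
      (kappa (thead e) \x prod_prob [tuple of behead e]) (@tcons _ _ m)
  end.

Lemma prod_prob_cons n e0 (e : n.-tuple E) A :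
  prod_prob [tuple of e0 :: e] A =
  (kappa e0 \x prod_prob e) (@tcons _ _ n @^-1` A).
Proof.
rewrite /= /distribution /pushforward theadE.
by rewrite (_ : [tuple of behead [tuple of e0 :: e]] = e)//; exact/val_inj.
Qed.

Lemma integral_tcons n (P1 : probability TR R) (P2 : probability (n.-tuple TR) R)
    (g : n.+1.-tuple TR -> \bar R) :
  measurable_fun setT g -> (forall x, 0 <= g x) ->
  \int[distribution (P1 \x P2) (@tcons _ _ n)]_z g z =
  \int[P1 \x P2]_p g (tcons p).
Proof.
by move=> mg g0; rewrite ge0_integral_pushforward.
Qed.

Lemma measurable_tcons_preimage n (A : set (n.+1.-tuple TR)) : measurable A ->
  measurable (@tcons _ _ n @^-1` A).
Proof.
by move=> mA; rewrite -[X in measurable X]setTI; exact: measurable_tcons.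
Qed.

(** For independent uniform indices every factor averages to mu: by induction for the tail of the
    tuple, then by [kappa_mean] for its head. *)
Lemma prod_prob_mean n (A : set (n.-tuple TR)) : measurable A ->
  emean (fun e : n.-tuple E => prod_prob e A) = power_prob mu n A.
Proof.
elim: n => [|n IH] in A *; move=> mA.
  rewrite /= /emean card_tuple expn0 invr1 mul1e.
  by rewrite (big_pred1 [tuple])// => t; apply/esym/eqP/tuple0.
have mB := measurable_tcons_preimage mA.
set B := _ @^-1` _ in mB.
rewrite emean_tuple_cons//.
transitivity (emean (fun e0 => \int[power_prob mu n]_x kappa e0 (ysection B x))).
  apply: eq_emean => e0.
  rewrite -(@emean_integral _ _ _ _ (@prod_prob n))//; last exact: measurable_fun_ysection.
  apply: eq_emean => e; rewrite prod_prob_cons product_prob_ysection//.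
  apply: eq_integral => x _; rewrite fineK// fin_num_measure//.
  exact: measurable_ysection.
rewrite -integral_emean//; last by move=> e; exact: measurable_fun_ysection.
rewrite /= /distribution/= /pushforward -/B product_prob_ysection//.
apply: eq_integral => x _; rewrite kappa_mean; last exact: measurable_ysection.
by rewrite fineK// fin_num_measure//; exact: measurable_ysection.
Qed.

Definition mean_bvar S : R := mean (fun e => bvar (kappa e) S).

Lemma measurable_bvar_fiber (P : probability TR R) n (A : set (n.-tuple TR)) i :
  measurable A -> measurable_fun setT (fun x => bvar P (fiber A i x)).
Proof.
move=> mA; apply: measurable_funM; first exact: measurable_prob_fiber.
by apply: measurable_funB => //; exact: measurable_prob_fiber.
Qed.

(** Efron-Stein separates the first coordinate under each [prod_prob e]; the variance in the
    remaining coordinates is bounded by induction on the sections of A. *)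
Lemma mean_bvar_prod_prob n (A : set (n.-tuple TR)) : measurable A ->
  (mean (fun e : n.-tuple E => bvar (prod_prob e) A))%:E <=
  \sum_(i < n) \int[power_prob mu n]_x (mean_bvar (fiber A i x))%:E.
Proof.
elim: n => [|n IH] in A *; move=> mA.
  rewrite big_ord0 lee_fin /mean big1 ?mul0r// => e _; rewrite /bvar.
  rewrite (_ : prod_prob e A = ([tuple] \in A)%:R%:E); last by rewrite /= diracE.
  by case: (_ \in _) => /=; rewrite ?subrr ?mulr0 ?mul0r.
have mB := measurable_tcons_preimage mA.
set B := _ @^-1` _ in mB.
have mBx x : measurable (xsection B x) by exact: measurable_xsection.
have mBy y : measurable (ysection B y) by exact: measurable_ysection.
have mbx (P : probability (n.-tuple TR) R) :
    measurable_fun setT (fun y => bvar P (xsection B y)).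
  have mf : measurable_fun setT (fun y => fine (P (xsection B y))).
    exact: (measurableT_comp (fine_measurable measurableT) (measurable_fun_xsection P mB)).
  by apply: measurable_funM => //; exact: measurable_funB.
have mby e : measurable_fun setT (fun x => bvar (kappa e) (ysection B x)).
  have mf : measurable_fun setT (fun x => fine (kappa e (ysection B x))).
    apply: (measurableT_comp (fine_measurable measurableT)).
    exact: (measurable_fun_ysection (kappa e) mB).
  by apply: measurable_funM => //; exact: measurable_funB.
have bge0 m (e : m.-tuple E) S : measurable S -> 0 <= (bvar (prod_prob e) S)%:E.
  by move=> mS; rewrite lee_fin; exact: bvar_ge0.
have kge0 e S : measurable S -> 0 <= (bvar (kappa e) S)%:E.
  by move=> mS; rewrite lee_fin; exact: bvar_ge0.
rewrite EFin_mean emean_tuple_cons; last by move=> e; exact: bge0.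
apply: (@le_trans _ _ (emean (fun e0 => emean (fun e : n.-tuple E =>
    \int[prod_prob e]_x (bvar (kappa e0) (ysection B x))%:E +
    \int[kappa e0]_y (bvar (prod_prob e) (xsection B y))%:E)))).
  apply: le_emean => e0; apply: le_emean => e.
  apply: le_trans (efron_stein_indic _ _ mB).
  by rewrite /bvar prod_prob_cons.
(* One variance term depends on e only through its head and the other only through its tail;
   averaging over the other part turns the law of the integration variable into [power_prob mu n],
   respectively mu. *)
have int1 e0 : emean (fun e : n.-tuple E =>
      \int[prod_prob e]_x (bvar (kappa e0) (ysection B x))%:E)
    = \int[power_prob mu n]_x (bvar (kappa e0) (ysection B x))%:E.
  apply: emean_integral; first exact: prod_prob_mean.
  - exact/measurable_EFinP.
  - by move=> x; exact: kge0.
have int2 (e : n.-tuple E) : emean (fun e0 =>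
      \int[kappa e0]_y (bvar (prod_prob e) (xsection B y))%:E)
    = \int[mu]_y (bvar (prod_prob e) (xsection B y))%:E.
  apply: emean_integral => //.
  - exact/measurable_EFinP.
  - by move=> x; exact: bge0.
under eq_emean.
  move=> e0; rewrite emeanD; last 2 first.
  - by move=> e; apply: integral_ge0 => x _; exact: kge0.
  - by move=> e; apply: integral_ge0 => y _; exact: bge0.
  rewrite int1; over.
rewrite emeanD; last 2 first.
- by move=> e; apply: integral_ge0 => x _; exact: kge0.
- by move=> e; apply: emean_ge0 => e'; apply: integral_ge0 => y _; exact: bge0.
rewrite exchange_emean; last first.
  by move=> e e'; apply: integral_ge0 => y _; exact: bge0.
under [X in _ + X]eq_emean do rewrite int2.
rewrite -!integral_emean//; last 4 first.
- by move=> e; exact/measurable_EFinP.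
- by move=> e x; exact: bge0.
- by move=> e; exact/measurable_EFinP.
- by move=> e x; exact: kge0.
rewrite big_ord_recl; apply: leeD.
  (* A fiber along the first coordinate ignores the first entry, so integrating that entry over mu
     contributes a factor 1. *)
  rewrite [leRHS](_ : _ = \int[mu \x power_prob mu n]_p (mean_bvar (ysection B p.2))%:E).
    rewrite fubini_tonelli2/=; last 2 first.
    - apply/measurable_EFinP.
      apply: (measurableT_comp (measurable_mean mby)).
      exact: measurable_snd.
    - by move=> p; rewrite lee_fin; apply: mean_ge0 => e; exact: bvar_ge0.
    apply: ge0_le_integral => //.
    - by move=> x _; apply: emean_ge0 => e; exact: kge0.
    - rewrite (_ : (fun x => _) = EFin \o (fun x => mean_bvar (ysection B x))).
        by apply/measurable_EFinP; exact: measurable_mean.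
      by apply/funext => x /=; rewrite EFin_mean.
    - rewrite /fubini_G/=; apply: (measurable_fun_fubini_tonelli_G
        (fun p => (mean_bvar (ysection B p.2))%:E)).
        apply/measurable_EFinP.
        apply: (measurableT_comp (measurable_mean mby)).
        exact: measurable_snd.
      by move=> p; rewrite lee_fin; apply: mean_ge0 => e; exact: bvar_ge0.
    move=> x _; rewrite /fubini_G/= integral_cst//.
    rewrite [X in _ * X](@probability_setT _ _ _ mu) mule1.
    by rewrite -EFin_mean.
  rewrite integral_tcons//.
  - by apply: eq_integral => -[y x] _; rewrite fiber_ord0.
  - apply/measurable_EFinP; apply: measurable_mean => e.
    exact: measurable_bvar_fiber.
  - move=> x; rewrite lee_fin; apply: mean_ge0 => e; apply: bvar_ge0.
    exact: measurable_fiber.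
pose g (i : 'I_n) (p : TR * n.-tuple TR) :=
  (mean_bvar (fiber A (lift ord0 i) (tcons p)))%:E.
have mg0 i : measurable_fun setT (fun z => mean_bvar (fiber A i z)).
  by apply: measurable_mean => e; exact: measurable_bvar_fiber.
have mg i : measurable_fun setT (g i).
  apply/measurable_EFinP; apply: (measurableT_comp (mg0 _)).
  exact: measurable_tcons.
have g0 i p : 0 <= g i p.
  rewrite lee_fin; apply: mean_ge0 => e; apply: bvar_ge0.
  exact: measurable_fiber.
have -> : \sum_(i < n) \int[power_prob mu n.+1]_x (mean_bvar (fiber A (lift ord0 i) x))%:E =
    \int[mu]_y \sum_(i < n) \int[power_prob mu n]_x g i (y, x).
  rewrite ge0_integral_sum//.
  - apply: eq_bigr => i _; rewrite integral_tcons; last 2 first.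
    + exact/measurable_EFinP.
    + move=> x; rewrite lee_fin; apply: mean_ge0 => e; apply: bvar_ge0.
      exact: measurable_fiber.
    exact: (fubini_tonelli1 (g i) (mg i) (g0 i)).
  - by move=> i; exact: measurable_fun_fubini_tonelli_F.
  - by move=> i y _; apply: integral_ge0.
apply: ge0_le_integral => //.
- by move=> y _; apply: emean_ge0 => e; exact: bge0.
- rewrite (_ : (fun x => _) = EFin \o (fun y => mean (fun e : n.-tuple E =>
      bvar (prod_prob e) (xsection B y)))).
    by apply/measurable_EFinP; exact: measurable_mean.
  by apply/funext => y /=; rewrite EFin_mean.
- by apply: emeasurable_sum => i; exact: measurable_fun_fubini_tonelli_F.
move=> y _; rewrite -EFin_mean; apply: (le_trans (IH _ (mBx y))).
apply: lee_sum => i _; rewrite le_eqVlt; apply/orP; left; apply/eqP.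
by apply: eq_integral => x _; rewrite /g fiber_lift.
Qed.

Definition upd n (i : 'I_n) (s : E -> E) (e : n.-tuple E) : n.-tuple E :=
  [tuple if j == i then s (tnth e j) else tnth e j | j < n].

Lemma upd_ord0 n (s : E -> E) e0 (e : n.-tuple E) :
  upd ord0 s [tuple of e0 :: e] = [tuple of s e0 :: e].
Proof.
apply: eq_from_tnth => i; rewrite tnth_mktuple.
by case: (unliftP ord0 i) => [j|] ->; rewrite ?tnthS// eqxx !tnth0.
Qed.

Lemma upd_lift n j (s : E -> E) e0 (e : n.-tuple E) :
  upd (lift ord0 j) s [tuple of e0 :: e] = [tuple of e0 :: upd j s e].
Proof.
apply: eq_from_tnth => i; rewrite tnth_mktuple.
case: (unliftP ord0 i) => [k|] ->; last by rewrite !tnth0.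
by rewrite !tnthS tnth_mktuple (inj_eq (@lift_inj _ _)).
Qed.

Definition mean_bdist (s : E -> E) S : R :=
  mean (fun e => `|fine (kappa e S) - fine (kappa (s e) S)|)%R.

(** Only the i-th factor changes. Integrating over the shared factors and moving the absolute value
    inside leaves the change of the i-th law on fibers, and averaging over the other indices turns
    the shared factors into mu. *)
Lemma mean_dist_prod_prob n (A : set (n.-tuple TR)) (i : 'I_n) s :
  measurable A ->
  (mean (fun e => `|fine (prod_prob e A) - fine (prod_prob (upd i s e) A)|)%R)%:E <=
  \int[power_prob mu n]_x (mean_bdist s (fiber A i x))%:E.
Proof.
elim: n => [|n IH] in A i *; move=> mA; first by case: i.
have mB := measurable_tcons_preimage mA.
set B := _ @^-1` _ in mB.
have mBx x : measurable (xsection B x) by exact: measurable_xsection.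
have mBy y : measurable (ysection B y) by exact: measurable_ysection.
have mfx (P : probability (n.-tuple TR) R) :
    measurable_fun setT (fun y => fine (P (xsection B y))).
  exact: (measurableT_comp (fine_measurable measurableT) (measurable_fun_xsection P mB)).
have mfy e : measurable_fun setT (fun x => fine (kappa e (ysection B x))).
  apply: (measurableT_comp (fine_measurable measurableT)).
  exact: (measurable_fun_ysection (kappa e) mB).
have md j : measurable_fun setT (fun z => mean_bdist s (fiber A j z)).
  apply: measurable_mean => e; apply: measurableT_comp => //.
  by apply: measurable_funB; exact: measurable_prob_fiber.
have d0 S : (0 <= mean_bdist s S)%R by exact: mean_ge0.
rewrite EFin_mean emean_tuple_cons//.
case: (unliftP ord0 i) => [j|] -> {i}.
(* Here i is not the first coordinate: the shared factor is [kappa e0], and its sections fall under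
   the induction hypothesis. *)
- rewrite integral_tcons; [|exact/measurable_EFinP|by move=> x; rewrite lee_fin].
  rewrite fubini_tonelli1; last 2 first.
  - apply/measurable_EFinP; apply: (measurableT_comp (md _)).
    exact: measurable_tcons.
  - by move=> p; rewrite lee_fin.
  pose D y (e : n.-tuple E) := (`|fine (prod_prob e (xsection B y)) -
           fine (prod_prob (upd j s e) (xsection B y))|)%R.
  have D0 x e : 0 <= (D x e)%:E by rewrite lee_fin /D normr_ge0.
  have mD e : measurable_fun setT (D ^~ e).
    by apply: measurableT_comp => //; exact: measurable_funB.
  apply: (@le_trans _ _ (emean (fun e0 => emean (fun e : n.-tuple E =>
      \int[kappa e0]_y (D y e)%:E)))).
    apply: le_emean => e0; apply: le_emean => e.
    rewrite upd_lift !prod_prob_cons !product_prob_xsection//.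
    by apply: normB_integral_le => // y; exact: fine_prob_itv.
  rewrite exchange_emean; last by move=> e0 e; apply: integral_ge0 => y _; exact: D0.
  rewrite (eq_emean (g := fun e => \int[mu]_y (D y e)%:E)); last first.
    move=> e; apply: emean_integral; first exact: kappa_mean.
    - exact/measurable_EFinP.
    - by move=> y; exact: D0.
  rewrite -integral_emean; last 2 first.
  - by move=> e; exact/measurable_EFinP.
  - by move=> e y; exact: D0.
  apply: ge0_le_integral => //.
  + by move=> y _; apply: emean_ge0 => e; exact: D0.
  + rewrite (_ : (fun x => _) = EFin \o (fun y => mean (D y))).
      by apply/measurable_EFinP; exact: measurable_mean.
    by apply/funext => y /=; rewrite EFin_mean.
  + apply: measurable_fun_fubini_tonelli_F; last by move=> p; rewrite lee_fin.
    apply/measurable_EFinP; apply: (measurableT_comp (md _)).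
    exact: measurable_tcons.
  move=> y _; rewrite -EFin_mean; apply: (le_trans (IH _ j (mBx y))).
  rewrite le_eqVlt; apply/orP; left; apply/eqP.
  by apply: eq_integral => x _; rewrite fiber_lift.
(* Here i is the first coordinate: the shared factor is [prod_prob e]. *)
- rewrite integral_tcons; [|exact/measurable_EFinP|by move=> x; rewrite lee_fin].
  rewrite fubini_tonelli2; last 2 first.
  - apply/measurable_EFinP; apply: (measurableT_comp (md _)).
    exact: measurable_tcons.
  - by move=> p; rewrite lee_fin.
  pose D x e0 := (`|fine (kappa e0 (ysection B x)) -
           fine (kappa (s e0) (ysection B x))|)%R.
  have D0 x e : 0 <= (D x e)%:E by rewrite lee_fin /D normr_ge0.
  have mD e : measurable_fun setT (D ^~ e).
    by apply: measurableT_comp => //; exact: measurable_funB.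
  apply: (@le_trans _ _ (emean (fun e0 => emean (fun e : n.-tuple E =>
      \int[prod_prob e]_x (D x e0)%:E)))).
    apply: le_emean => e0; apply: le_emean => e.
    rewrite upd_ord0 !prod_prob_cons !product_prob_ysection//.
    by apply: normB_integral_le => // y; exact: fine_prob_itv.
  rewrite (eq_emean (g := fun e0 => \int[power_prob mu n]_x (D x e0)%:E)); last first.
    move=> e0; apply: emean_integral ; first exact: prod_prob_mean.
    - exact/measurable_EFinP.
    - by move=> y; exact: D0.
  rewrite -integral_emean; last 2 first.
  - by move=> e; exact/measurable_EFinP.
  - by move=> e y; exact: D0.
  apply: ge0_le_integral => //.
  + by move=> y _; apply: emean_ge0 => e; exact: D0.
  + rewrite (_ : (fun x => _) = EFin \o (fun y => mean (D y))).
      by apply/measurable_EFinP; exact: measurable_mean.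
    by apply/funext => y /=; rewrite EFin_mean.
  + apply: measurable_fun_fubini_tonelli_G; last by move=> p; rewrite lee_fin.
    apply/measurable_EFinP; apply: (measurableT_comp (md _)).
    exact: measurable_tcons.
  move=> x _; rewrite -EFin_mean /fubini_G.
  under eq_integral do rewrite fiber_ord0.
  by rewrite integral_cst// [X in _ * X](@probability_setT _ _ _ mu) mule1.
Qed.

End randomized_product.

(** * Crossing masses and Minkowski content *)

Section lower_integral.
Context d (T : measurableType d) (R : realType).
Variable mu : {measure set T -> \bar R}.
Local Open Scope ereal_scope.

(* The integral of a nonnegative function is the supremum of the integrals of the
   simple functions below it. *)
Lemma le_integral_nonmeasurable (f g : T -> \bar R) :
  (forall x, 0 <= f x) -> (forall x, f x <= g x) ->
  \int[mu]_x f x <= \int[mu]_x g x.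
Proof.
move=> f0 fg; rewrite !ge0_integralTE//; last first.
  by move=> x; exact: le_trans (fg x).
apply: ereal_sup_le => _ [h hf <-]; exists h => // x.
exact: le_trans (hf x) (fg x).
Qed.

Lemma subset_integral_nonmeasurable (A B : set T) (f : T -> \bar R) :
  (forall x, 0 <= f x) -> A `<=` B ->
  \int[mu]_(x in A) f x <= \int[mu]_(x in B) f x.
Proof.
move=> f0 AB; rewrite [leLHS]integral_mkcond [leRHS]integral_mkcond.
apply: le_integral_nonmeasurable => x; rewrite /patch.
  by case: ifP.
case: ifPn => [|_]; last by case: ifP.
by rewrite inE => /AB Bx; rewrite mem_set.
Qed.

End lower_integral.

Section minkowski.
Context (R : realType).
Local Notation TR := (measurableTypeR R).
Local Notation leb := (@lebesgue_measure R).
Implicit Types (S : set R) (r x y z : R).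

(* The open neighbourhood is Borel for every S and is contained in the closed one
   of [lower_minkowski_content], whose measurability is thus never needed. *)
Definition enlarge S r : set R := [set y | exists2 s, S s & `|y - s| < r].

Lemma open_enlarge S r : open (enlarge S r).
Proof.
rewrite (_ : enlarge S r = \bigcup_(s in S) `]s - r, s + r[%classic).
  by apply: bigcup_open => s _; exact: interval_open.
by apply/seteqP; split=> y [s Ss];
  [rewrite ltr_distl|rewrite /= in_itv/= -ltr_distl] => ys; exists s => //;
  rewrite /= in_itv/= -ltr_distl.
Qed.

Lemma measurable_enlarge S r : measurable (enlarge S r : set TR).
Proof. apply: open_measurable; exact: open_enlarge. Qed.

Lemma sub_enlarge S r : 0 < r -> S `<=` enlarge S r.
Proof. by move=> r0 x Sx; exists x => //; rewrite subrr normr0. Qed.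

Definition collar S r : set TR := enlarge S r `\` S.

Lemma measurable_collar S r : measurable (S : set TR) -> measurable (collar S r).
Proof. by move=> mS; apply: measurableD => //; exact: measurable_enlarge. Qed.

(** Take for a the supremum of the points of S up to y. Points of S come arbitrarily close to a from
    below, so []a, a + r[] is in the neighbourhood; it contains no point of S because it lies
    between a and y. *)
Lemma collar_right S r x y : S x -> ~ enlarge S r y -> x < y ->
  exists2 a, x <= a & a + r <= y /\ `]a, a + r[ `<=` collar S r.
Proof.
move=> Sx ny xy; pose V := S `&` [set s | s <= y].
have Vx : V x by split=> //=; exact: ltW.
have V_sup : has_sup V by split; [exists x|exists y => s []].
have Vy s : V s -> s + r <= y.
  move=> [Ss sy]; rewrite leNgt; apply/negP => ysr; apply: ny; exists s => //.
  by rewrite ger0_norm ?subr_ge0// ltrBlDl.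
have ar : sup V + r <= y.
  by rewrite -lerBrDr; apply: ge_sup; [exists x|move=> s /Vy; rewrite lerBrDr].
exists (sup V); first exact: sup_upper_bound.
split=> // z; rewrite /= in_itv/= => /andP[az zar]; split.
  have [|s Vs sz] := @sup_adherent _ V (r - (z - sup V)) _ V_sup.
    by rewrite subr_gt0 ltrBlDl.
  exists s; first by case: Vs.
  have sa : s <= sup V by exact: sup_upper_bound.
  by rewrite ger0_norm; lra.
move=> Sz; have : V z by split=> //=; lra.
by move/(sup_upper_bound V_sup); rewrite leNgt az.
Qed.

Lemma collar_left S r x y : S x -> ~ enlarge S r y -> y < x ->
  exists2 a, a <= x & y <= a - r /\ `]a - r, a[ `<=` collar S r.
Proof.
move=> Sx ny yx; pose V := S `&` [set s | y <= s].
have Vx : V x by split=> //=; exact: ltW.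
have V_inf : has_inf V by split; [exists x|exists y => s []].
have Vy s : V s -> y <= s - r.
  move=> [Ss sy]; rewrite leNgt; apply/negP => ysr; apply: ny; exists s => //.
  by rewrite distrC ger0_norm ?subr_ge0//; move: ysr; lra.
have ar : y <= inf V - r.
  by rewrite lerBrDr; apply: lb_le_inf; [exists x|move=> s /Vy; rewrite lerBrDr].
have lbV s : V s -> inf V <= s by apply: ge_inf; case: V_inf.
exists (inf V); first exact: lbV.
split=> // z; rewrite /= in_itv/= => /andP[az zar]; split.
  have [|s Vs sz] := @inf_adherent _ V (r - (inf V - z)) _ V_inf.
    by rewrite subr_gt0; lra.
  exists s; first by case: Vs.
  have sa := lbV _ Vs.
  by rewrite distrC ger0_norm; lra.
move=> Sz; have : V z by split=> //=; lra.
by move/lbV; rewrite leNgt zar.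
Qed.

Definition between x y : set R := [set z | (x <= z <= y) || (y <= z <= x)].

Lemma collar_between S r x y : 0 < r -> measurable (S : set TR) ->
  S x -> ~ enlarge S r y -> (r%:E <= leb (collar S r `&` between x y))%E.
Proof.
move=> r0 mS Sx ny.
have mb : measurable (between x y : set TR).
  rewrite (_ : between x y = `[x, y] `|` `[y, x]); first exact: measurableU.
  apply/seteqP; split=> z; rewrite /between/= !in_itv/=; first by move/orP.
  by case=> ->; rewrite ?orbT.
have mC : measurable (collar S r `&` between x y).
  by apply: measurableI => //; exact: measurable_collar.
have key a : `]a, a + r[ `<=` collar S r `&` between x y ->
    (r%:E <= leb (collar S r `&` between x y))%E.
  move=> sub; apply: (@le_trans _ _ (leb `]a, a + r[%classic)).
    by rewrite lebesgue_measure_itv/= lte_fin ltrDl r0 -EFinB addrAC subrr add0r.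
  by apply: le_measure => //; rewrite inE.
have [xy|yx|xy] := ltgtP x y.
- have [a xa [ay sub]] := collar_right Sx ny xy.
  apply: (key a) => z az; split; first exact: sub.
  by move: az; rewrite /between/= in_itv/= => /andP[? ?]; apply/orP; left; lra.
- have [a xa [ay sub]] := collar_left Sx ny yx.
  apply: (key (a - r)); rewrite subrK => z az; split; first exact: sub.
  by move: az; rewrite /between/= in_itv/= => /andP[? ?]; apply/orP; right; lra.
- by exfalso; apply: ny; rewrite -xy; exact: sub_enlarge.
Qed.

(** The P x Q mass of the pairs with z between their entries, except that the pair (z, z) counts
    twice. *)
Definition crossing (P Q : probability TR R) z : R :=
  fine (P `]-oo, z]%classic) * fine (Q `[z, +oo[%classic) +
  fine (P `[z, +oo[%classic) * fine (Q `]-oo, z]%classic).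

Lemma measurable_crossing (P Q : probability TR R) :
  measurable_fun [set: TR] (crossing P Q).
Proof.
have mI (b : itv_bound R) c : measurable ([set` Interval b c] : set TR) by [].
have mlo (M : probability TR R) :
    measurable_fun [set: TR] (fun z : TR => fine (M `]-oo, z]%classic)).
  apply: nondecreasing_measurable => // z1 z2 z12.
  apply: fine_le; rewrite ?fin_num_measure//.
  apply: le_measure; rewrite ?inE// => z /=; rewrite !in_itv/= => /le_trans; exact.
have mhi (M : probability TR R) :
    measurable_fun [set: TR] (fun z : TR => fine (M `[z, +oo[%classic)).
  apply: nonincreasing_measurable => // z1 z2 z12.
  apply: fine_le; rewrite ?fin_num_measure//.
  by apply: le_measure; rewrite ?inE// => z /=; rewrite !in_itv/= !andbT; exact: le_trans.
by apply: measurable_funD; apply: measurable_funM.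
Qed.

(** Integrate over P x Q the length of the part of the collar between x and y. It is at least r when
    x is in S and y outside the neighbourhood; by Tonelli the same integral is that of the mass of
    crossing pairs over the collar. *)
Lemma crossing_bound (P Q : probability TR R) S r :
  0 < r -> measurable (S : set TR) ->
  ((r * (fine (P S) * fine (Q (~` enlarge S r))))%:E <=
   \int[leb]_(z in collar S r) (crossing P Q z)%:E)%E.
Proof.
move=> r0 mS.
have mC := measurable_collar r mS.
have mU : measurable (~` enlarge S r : set TR).
  by apply: measurableC; exact: measurable_enlarge.
pose W : set ((TR * TR) * TR) := [set p | collar S r p.2 /\ between p.1.1 p.1.2 p.2].
have mx : measurable_fun setT (fun p : (TR * TR) * TR => p.1.1).
  exact: (measurableT_comp measurable_fst measurable_fst).
have my : measurable_fun setT (fun p : (TR * TR) * TR => p.1.2).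
  exact: (measurableT_comp measurable_snd measurable_fst).
have mz : measurable_fun setT (fun p : (TR * TR) * TR => p.2).
  exact: measurable_snd.
have mle (f g : (TR * TR) * TR -> R) : measurable_fun setT f -> measurable_fun setT g ->
    measurable [set p | f p <= g p].
  move=> mf mg; rewrite -[X in measurable X]setTI.
  exact: measurable_fun_le.
have mW : measurable W.
  rewrite (_ : W = (snd @^-1` collar S r) `&`
    (([set p | p.1.1 <= p.2] `&` [set p | p.2 <= p.1.2]) `|`
     ([set p | p.1.2 <= p.2] `&` [set p | p.2 <= p.1.1]))).
    apply: measurableI.
      by rewrite -[X in measurable X]setTI; exact: mz.
    by apply: measurableU; apply: measurableI; exact: mle.
  apply/seteqP; split=> p.
    by move=> [Cp /orP[/andP[h1 h2]|/andP[h1 h2]]]; split=> //; [left|right].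
  by move=> [Cp [[h1 h2]|[h1 h2]]]; split=> //; apply/orP; [left|right]; exact/andP.
pose PQ : probability _ R := (P \x Q)%E.
have E12 : (\int[PQ]_p leb (xsection W p) = \int[leb]_z PQ (ysection W z))%E.
  transitivity ((PQ \x leb) W)%E => //.
  transitivity ((PQ \x^ leb) W)%E => //.
  apply: product_measure_unique => // A1 A2 mA1 mA2.
  exact: (@product_measure2E _ _ _ _ _ PQ leb A1 A2 mA1 mA2).
apply: (@le_trans _ _ (\int[PQ]_p leb (xsection W p))%E).
  apply: (@le_trans _ _ (\int[PQ]_(p in S `*` ~` enlarge S r) (cst r%:E) p)%E).
    rewrite integral_cst//; last exact: measurableX.
    rewrite [X in (_ * X)%E]product_measure1E// EFinM.
    apply: lee_wpmul2l; first by rewrite lee_fin ltW.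
    by rewrite EFinM !fineK// fin_num_measure.
  rewrite integral_mkcond; apply: ge0_le_integral => //.
  - by move=> p _; rewrite /patch; case: ifP => // _; rewrite lee_fin ltW.
  - apply/(measurable_restrictT _ _).1 => //; exact: measurableX.
  - exact: measurable_fun_xsection.
  move=> [x y] _; rewrite /patch; case: ifPn => [|_]; last exact: measure_ge0.
  rewrite inE => -[/= Sx ny].
  apply: (le_trans (collar_between r0 mS Sx ny)).
  rewrite le_eqVlt; apply/orP; left; apply/eqP; congr (leb _).
  by apply/seteqP; split => z; [move=> ?; apply/xsectionP|move/xsectionP].
rewrite E12 [leRHS]integral_mkcond.
have mI (b : itv_bound R) c : measurable ([set` Interval b c] : set TR) by [].
apply: ge0_le_integral => //.
- exact: measurable_fun_ysection.
- apply/(measurable_restrictT _ _).1 => //; apply: measurable_funTS.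
  apply/measurable_EFinP; exact: measurable_crossing.
move=> z _; rewrite /patch; case: ifPn => zC; last first.
  rewrite (_ : ysection W z = set0) ?measure0//.
  apply/seteqP; split=> // p /ysectionP[/= Cz _].
  by move: zC; rewrite mem_set.
apply: (@le_trans _ _ (PQ ((`]-oo, z] `*` `[z, +oo[) `|` (`[z, +oo[ `*` `]-oo, z])))).
  apply: le_measure; rewrite ?inE.
  - exact: measurable_ysection.
  - by apply: measurableU; exact: measurableX.
  move=> [x y] /ysectionP[/= _]; rewrite /between/= => /orP[/andP[? ?]|/andP[? ?]].
    by left; split; rewrite /= in_itv/= ?andbT.
  by right; split; rewrite /= in_itv/= ?andbT.
apply: (le_trans (measureU2 _ _ _)); try exact: measurableX.
rewrite [X in (X + _)%E]product_measure1E// [X in (_ + X)%E]product_measure1E//.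
by rewrite EFinD !EFinM !fineK// fin_num_measure.
Qed.

(** The Gaussian mass of any set is an integral of the density, hence a supremum over simple
    functions; the sets can thus be arbitrary, such as the closed neighbourhoods in the content. *)
Lemma gaussian_le (A B : set TR) : A `<=` B -> (gaussian R A <= gaussian R B)%E.
Proof.
move=> AB; apply: subset_integral_nonmeasurable => // x.
by rewrite lee_fin normal_pdf_ge0.
Qed.

(** The interval []0, delta[] is one of the neighbourhoods in the supremum that defines the lower
    limit, and the increment of mass is at least that of the open collar. *)
Lemma content_ge S (q c delta : R) : measurable (S : set TR) ->
  0 <= q -> 0 < c -> 0 < delta ->
  (forall r, 0 < r -> r < delta ->
    ((r * q)%:E <= c%:E * gaussian R (collar S r))%E) ->
  ((q / c)%:E <= lower_minkowski_content (gaussian R) S)%E.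
Proof.
move=> mS q0 c0 d0 H; rewrite /lower_minkowski_content limf_einfE.
set f := fun r : R => _.
apply: le_ereal_sup_tmp; exists (ereal_inf (f @` `]0, delta[%classic)).
  exists `]0, delta[%classic => //.
  near=> r; rewrite /= in_itv/=; apply/andP; split.
    by near: r; exact: nbhs_right_gt.
  by near: r; exact: nbhs_right_lt.
apply: le_ereal_inf_tmp => y [r]; rewrite /= in_itv/= => /andP[r0 rd] <-{y}.
rewrite /f.
have mC := measurable_collar r mS.
have mU := measurable_enlarge S r.
rewrite lee_pdivlMr// -EFinM.
have gS : gaussian R S \is a fin_num by exact: fin_num_measure.
apply: (@le_trans _ _ (gaussian R (collar S r))).
  have := H r r0 rd.
  rewrite -lee_pdivrMl// -EFinM; apply: le_trans.
  by rewrite lee_fin le_eqVlt; apply/orP; left; apply/eqP; ring.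
rewrite leeBrDr//.
rewrite -measureU//; last by apply/seteqP; split=> // y [[_ ?]].
rewrite setUC setDUK; last exact: sub_enlarge.
apply: gaussian_le => y [s Ss ysr]; exists s => //; exists (y - s).
  by rewrite /= in_itv/=; move: ysr; rewrite ltr_norml; lra.
by rewrite addrC subrK.
Unshelve. all: by end_near.
Qed.

(** Outside S a point is either outside the neighbourhood, where [crossing_bound] applies, or in the
    collar, whose Q-mass is at most K times its Gaussian mass. For r < k / K both contributions,
    multiplied by r, are at most k times the Gaussian mass of the collar. So K only limits the range
    of r and may be huge. *)
Lemma mean_crossing_content (E : finType) (P Q : E -> probability TR R) S
    (k K : R) : 0 < k -> 0 < K -> measurable (S : set TR) ->
  (forall z, mean (fun e => crossing (P e) (Q e) z) <= k * normal_pdf 0 1 z) ->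
  (forall e X, measurable X -> (Q e X <= K%:E * gaussian R X)%E) ->
  ((mean (fun e => fine (P e S) * fine (Q e (~` S))) / (2 * k))%:E <=
    lower_minkowski_content (gaussian R) S)%E.
Proof.
move=> k0 K0 mS Hk HK.
have f0 (M : probability TR R) X : 0 <= fine (M X) by exact: fine_ge0.
apply: (@content_ge S _ _ (k / K)) => //.
- by apply: mean_ge0 => e; rewrite mulr_ge0.
- by rewrite mulr_gt0.
- by rewrite divr_gt0.
move=> r r0 rkK.
have mC := measurable_collar r mS.
have mU := measurable_enlarge S r.
have mUC := measurableC mU.
set G := gaussian R (collar S r).
have Gfin : G \is a fin_num by exact: fin_num_measure.
have split_e e : fine (P e S) * fine (Q e (~` S)) <=
    fine (P e S) * fine (Q e (~` enlarge S r)) + K * fine G.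
  have -> : ~` S = ~` enlarge S r `|` collar S r.
    apply/seteqP; split=> y.
      by move=> nS; have [yU|yU] := pselect (enlarge S r y); [right|left].
    by move=> [nU Sy|[]//]; apply: nU; exact: sub_enlarge.
  rewrite measureU//; last first.
    by apply/seteqP; split=> // y [nU [Uy _]].
  rewrite fineD ?fin_num_measure// mulrDr lerD2l.
  have /andP[_ P1] := fine_prob_itv (P e) mS.
  apply: (@le_trans _ _ (fine (Q e (collar S r)))); first by rewrite ler_piMl.
  rewrite -lee_fin EFinM !fineK ?fin_num_measure//.
  exact: HK.
have int_le : ((r * mean (fun e => fine (P e S) * fine (Q e (~` enlarge S r))))%:E <=
    k%:E * G)%E.
  rewrite -meanZ EFin_mean.
  apply: (@le_trans _ _ (emean (fun e =>
     \int[leb]_(z in collar S r) (crossing (P e) (Q e) z)%:E)))%E.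
    by apply: le_emean => e; exact: crossing_bound.
  have cr0 e z : (0 <= (crossing (P e) (Q e) z)%:E)%E.
    by rewrite lee_fin addr_ge0// mulr_ge0.
  have mcr e : measurable_fun (collar S r) (fun z : TR => (crossing (P e) (Q e) z)%:E).
    by apply: measurable_funTS; apply/measurable_EFinP; exact: measurable_crossing.
  rewrite /emean -ge0_integral_sum// -ge0_integralZl; [|exact: mC| | |]; last 3 first.
  - by apply: emeasurable_sum => e.
  - by move=> z _; apply: sume_ge0 => e _.
  - by rewrite lee_fin invr_ge0.
  rewrite /G /gaussian /= /normal_prob -ge0_integralZl; [|exact: mC| | |]; last 3 first.
  - apply: measurable_funTS; apply/measurable_EFinP; exact: measurable_normal_pdf.
  - by move=> z _; rewrite lee_fin normal_pdf_ge0.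
  - by rewrite lee_fin ltW.
  apply: ge0_le_integral => //.
  - by move=> z _; apply: mule_ge0; [rewrite lee_fin invr_ge0|exact: sume_ge0].
  - apply: emeasurable_funM => //; exact: emeasurable_sum.
  - apply: measurable_funTS; apply/measurable_EFinP; apply: measurable_funM => //.
    exact: measurable_normal_pdf.
  move=> z _; rewrite -[leLHS]/(emean (fun e => (crossing (P e) (Q e) z)%:E)).
  by rewrite -EFin_mean -EFinM lee_fin.
have := int_le; rewrite -[G]fineK// -!EFinM !lee_fin => int_le'.
set q := mean _; set q' := mean _ in int_le'.
have qq' : q <= q' + K * fine G.
  have : q <= mean (fun e => fine (P e S) * fine (Q e (~` enlarge S r)) + K * fine G).
    exact: le_mean.
  rewrite meanD; move/le_trans; apply; rewrite lerD2l.
  rewrite /mean sumr_const.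
  have [E0|E0] := posnP #|E|; first rewrite E0 mulr0n mul0r.
    by apply: mulr_ge0; [exact: ltW|exact: f0].
  by rewrite -[X in X / _]mulr_natr mulfK// pnatr_eq0 -lt0n.
have rK : r * K <= k by rewrite -ler_pdivlMr// ltW.
have G0 : 0 <= fine G by exact: f0.
nra.
Qed.

End minkowski.

(** * Gaussian tails *)

Section gaussian_tail.
Context (R : realType).
Local Notation TR := (measurableTypeR R).
Local Notation leb := (@lebesgue_measure R).
Local Notation phi := (@normal_pdf R 0 1).
Local Notation peak := (@normal_peak R 1).
Local Notation gamma := (gaussian R).
Implicit Types x y z : R.

Lemma peak_gt0 : 0 < peak.
Proof. by rewrite normal_peak_gt0// oner_neq0. Qed.

Lemma gauss_pdfE z : phi z = peak * expR (- (z ^+ 2 / 2)).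
Proof.
by rewrite normal_pdfE ?oner_neq0// /normal_fun subr0 expr1n -[1 *+ 2]/(2%:R) mulNr.
Qed.

Lemma gauss_pdf_gt0 z : 0 < phi z.
Proof. by rewrite gauss_pdfE mulr_gt0 ?peak_gt0 ?expR_gt0. Qed.

Lemma gauss_pdfN z : phi (- z) = phi z.
Proof. by rewrite !gauss_pdfE sqrrN. Qed.

Lemma gauss_pdf_le x y : 0 <= x -> x <= y -> phi y <= phi x.
Proof.
move=> x0 xy; rewrite !gauss_pdfE ler_pM2l ?peak_gt0// ler_expR lerN2.
by rewrite ler_pM2r ?invr_gt0// ler_pXn2r// nnegrE; apply: (le_trans x0).
Qed.

Let continuous_phi : continuous phi.
Proof. by apply: continuous_normal_pdf; exact: oner_neq0. Qed.

Let measurable_phi (D : set TR) : measurable_fun D (fun x : TR => (phi x)%:E).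
Proof.
by apply: measurable_funTS; apply/measurable_EFinP; exact: measurable_normal_pdf.
Qed.

Let phi_ge0 z : (0 <= (phi z)%:E)%E.
Proof. by rewrite lee_fin ltW// gauss_pdf_gt0. Qed.

Lemma gaussian_set1 x : gamma [set x] = 0%E.
Proof. by rewrite /gaussian/= /normal_prob integral_set1. Qed.

Definition tail z : R := fine (gamma `]z, +oo[%classic).

Lemma tailE z : gamma `]z, +oo[%classic = (tail z)%:E.
Proof. by rewrite /tail fineK// fin_num_measure. Qed.

Lemma tail_closedE z : gamma `[z, +oo[%classic = (tail z)%:E.
Proof.
rewrite -tailE /gaussian/= /normal_prob -integral_itv_obnd_cbnd//.
exact: measurable_phi.
Qed.

Lemma tail_le1 z : tail z <= 1.
Proof. by have /andP[] := fine_prob_itv gamma (measurable_itv `]z, +oo[). Qed.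

Lemma tail_ge0 z : 0 <= tail z.
Proof. exact: fine_ge0. Qed.

Lemma tail_noninc x y : x <= y -> tail y <= tail x.
Proof.
move=> xy; rewrite /tail fine_le ?fin_num_measure//.
apply: le_measure; rewrite ?inE//.
by move=> z; rewrite /= !in_itv/= !andbT; exact: le_lt_trans.
Qed.

Lemma gaussian_itv_le x y : x <= y -> (gamma `]x, y]%classic <= (peak * (y - x))%:E)%E.
Proof.
move=> xy; rewrite /gaussian/= /normal_prob.
apply: (@le_trans _ _ (\int[leb]_(z in `]x, y]) (cst peak%:E z))%E).
  apply: ge0_le_integral => //= z _; rewrite lee_fin normal_pdf_ub//; exact: oner_neq0.
rewrite integral_cst//= lebesgue_measure_itv/= lte_fin.
case: ltP => _; first by rewrite -EFinB -EFinM.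
by rewrite mule0 lee_fin mulr_ge0 ?subr_ge0// ltW// peak_gt0.
Qed.

Lemma tail_diff x y : x <= y -> tail x = tail y + fine (gamma `]x, y]%classic).
Proof.
move=> xy; rewrite /tail -fineD ?fin_num_measure//; congr fine.
rewrite -measureU//; last first.
  apply/seteqP; split=> // z [/=]; rewrite !in_itv/= andbT => yz /andP[_].
  by rewrite leNgt yz.
congr (gamma _); apply/seteqP; split=> z /=; rewrite !in_itv/= !andbT.
  by move=> xz; case: (ltP y z); [left|rewrite xz; right].
by case=> [|/andP[]//]; exact: le_lt_trans.
Qed.

Lemma tail_lipschitz x y : x <= y -> tail x - tail y <= peak * (y - x).
Proof.
move=> xy; rewrite (tail_diff xy) addrAC subrr add0r -lee_fin fineK ?fin_num_measure//.
exact: gaussian_itv_le.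
Qed.

(** On []z, z + 1]] the density is at least its value at the right end. *)
Lemma gauss_pdf_le_tail z : 0 <= z -> phi (z + 1) <= tail z.
Proof.
move=> z0; rewrite (@tail_diff z (z + 1)) ?lerDl//.
rewrite -[leLHS]add0r lerD ?tail_ge0//.
rewrite -lee_fin fineK ?fin_num_measure//.
apply: (@le_trans _ _ (\int[leb]_(x in `]z, (z + 1)%R]) (cst (phi (z + 1))%:E x))%E).
  rewrite integral_cst//= lebesgue_measure_itv/= lte_fin ltrDl ltr01.
  by rewrite -EFinB addrAC subrr add0r mule1.
rewrite /gaussian/= /normal_prob; apply: ge0_le_integral => //= x.
rewrite in_itv/= => /andP[zx xz]; rewrite lee_fin; apply: gauss_pdf_le => //.
exact/(le_trans z0)/ltW.
Qed.

Let cvg_phi : - phi x @[x --> +oo] --> (- 0 : R).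
Proof.
apply: cvgN; rewrite (_ : phi = fun z => peak * expR (- (z ^+ 2 / 2))).
  rewrite -[X in _ --> X](mulr0 peak); apply: cvgMr.
  apply: (cvg_comp (fun x => x ^+ 2 / 2) (fun x => expR (- x))); last exact: cvgr_expR.
  apply: gt0_cvgMly => //; exact: cvgr_expr2.
by apply/funext => z; rewrite gauss_pdfE.
Qed.

Let is_derive_phi x : is_derive x 1 (fun z => - phi z) (x * phi x).
Proof.
rewrite (_ : (fun z => - phi z) = fun z => (- peak) * expR (- (z ^+ 2 / 2))); last first.
  by apply/funext => z; rewrite gauss_pdfE mulNr.
apply: is_derive_eq.
by rewrite gauss_pdfE /GRing.scale/=; field.
Qed.

(** The Mills bound: x may be replaced by the larger integration variable z, and z [phi] z has the
    antiderivative - [phi]. *)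
Lemma mills x : 0 < x -> x * tail x <= phi x.
Proof.
move=> x0; rewrite -lee_fin EFinM -tail_closedE /gaussian/= /normal_prob.
rewrite -ge0_integralZl; [|exact: measurable_itv|exact: measurable_phi| |]; last 2 first.
- by move=> z _; exact: phi_ge0.
- by rewrite lee_fin ltW.
apply: (@le_trans _ _ (\int[leb]_(z in `[x, +oo[) (z * phi z)%:E)%E).
  apply: ge0_le_integral => //.
  - by move=> z _; apply: mule_ge0 => //; rewrite lee_fin ltW.
  - by apply: emeasurable_funM.
  - by apply/measurable_EFinP; apply: measurable_funTS; apply: measurable_funM => //;
      exact: measurable_normal_pdf.
  move=> z; rewrite /= in_itv/= andbT => xz; rewrite lee_fin ler_wpM2r// ltW//.
  exact: gauss_pdf_gt0.
rewrite (@ge0_continuous_FTC2y _ _ (fun z => - phi z) x (- 0)).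
- by rewrite oppr0 sub0e EFinN oppeK.
- move=> z xz; rewrite mulr_ge0 ?(ltW (gauss_pdf_gt0 _))//; exact/(le_trans (ltW x0)).
- apply: continuous_subspaceT => z; apply: cvgM; first exact: cvg_id.
  exact: continuous_phi.
- exact: cvg_phi.
- by move=> z _; have dphi := is_derive_phi z; exact: ex_derive.
- by apply: cvg_at_right_filter; apply: cvgN; exact: continuous_phi.
- by move=> z _; have dphi := is_derive_phi z; rewrite derive1E derive_val.
Qed.

(** For z >= 1 this follows from [mills] with 1 + z <= 2 z; for z < 1 the left side is at most 2 and
    the density is at least its value at 1. *)
Lemma tail_le : exists2 C : R, 0 < C & forall z, 0 <= z -> (1 + z) * tail z <= C * phi z.
Proof.
exists (2 + 2 / phi 1); first by rewrite addr_gt0// divr_gt0// gauss_pdf_gt0.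
move=> z z0; have := gauss_pdf_gt0 z; have t1 := tail_le1 z; have t0 := tail_ge0 z.
have p1 := gauss_pdf_gt0 1; move=> p0.
have [z1|z1] := leP 1 z.
  have m := mills (lt_le_trans ltr01 z1).
  apply: (@le_trans _ _ (2 * phi z)); first by nra.
  by rewrite ler_pM2r// lerDl divr_ge0// ltW.
apply: (@le_trans _ _ 2); first by nra.
rewrite mulrDl -[leLHS]add0r lerD//; first by rewrite mulr_ge0// ltW.
rewrite mulrAC ler_pdivlMr// ler_pM2l//.
by apply: gauss_pdf_le => //; exact: ltW.
Qed.

Lemma gaussian_lower_tail z : gamma `]-oo, z]%classic = (tail (- z))%:E.
Proof.
rewrite -tail_closedE /gaussian/= /normal_prob -[in LHS](opprK z).
rewrite ge0_integration_by_substitutionNy.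
- by apply: eq_integral => x _ /=; rewrite gauss_pdfN.
- exact: continuous_subspaceT.
- by move=> x _; rewrite ltW// gauss_pdf_gt0.
Qed.

Lemma tailN z : tail (- z) = 1 - tail z.
Proof.
apply: EFin_inj; rewrite -gaussian_lower_tail EFinB -tailE -setCitvr.
by rewrite probability_setC.
Qed.

(** The tail is Lipschitz with constant [peak], so the intermediate value theorem applies once it is
    shown to take values below and above p. *)
Lemma tail_quantile p : 0 < p < 1 -> exists z, tail z = p.
Proof.
move=> /andP[p0 p1].
have [C C0 HC] := tail_le.
have upper q : 0 < q -> exists2 b, 0 <= b & tail b <= q.
  (* This b satisfies b q = C [peak], so (1 + b) [tail b] <= C [phi b] <= b q <= (1 + b) q. *)
  move=> q0; exists (C * peak / q); first by rewrite !mulr_ge0 ?invr_ge0// ltW// peak_gt0.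
  set b := C * peak / q.
  have b0 : 0 <= b by rewrite !mulr_ge0 ?invr_ge0// ltW// peak_gt0.
  have := HC b b0; have : phi b <= peak by rewrite normal_pdf_ub// oner_neq0.
  have bq : b * q = C * peak by rewrite divfK// gt_eqF.
  have := tail_ge0 b; move=> t0 h1 h2.
  have h3 : (1 + b) * tail b <= (1 + b) * q.
    apply: (le_trans h2); apply: (@le_trans _ _ (C * peak)).
      by rewrite ler_pM2l.
    by rewrite -bq ler_wpM2r ?ltW// ltrDr.
  by rewrite -(@ler_pM2l _ (1 + b))//; lra.
have [b b0 tb] := upper p p0.
have [a a0 ta] := upper (1 - p) ltac:(lra).
have ab : - a <= b by lra.
have [||c _ <-] := @IVT R tail (- a) b p ab; last by exists c.
  apply: continuous_subspaceT => x; apply/cvgrPdist_lt => e e0.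
  exists (e / peak); first by rewrite /= divr_gt0// peak_gt0.
  move=> y /=; rewrite ltr_pdivlMr ?peak_gt0// => xy.
  apply: le_lt_trans xy; have [xy|/ltW xy] := leP x y.
    rewrite ger0_norm ?subr_ge0 ?tail_noninc// distrC ger0_norm ?subr_ge0// mulrC.
    exact: tail_lipschitz.
  rewrite distrC ger0_norm ?subr_ge0 ?tail_noninc// ger0_norm ?subr_ge0// mulrC.
  exact: tail_lipschitz.
have ta' : p <= tail (- a) by rewrite tailN; lra.
by rewrite ge_min le_max tb ta' orbT.
Qed.

End gaussian_tail.

(** * Bits and Gaussian cells *)

Section subgaussian.
Context (R : realType).
Implicit Types x : R.

(** A fair sign is subgaussian. For |x| <= 1 a quadratic bound on the exponential is averaged over x
    and - x; for |x| > 1 both exponents are at most 2 x^2. *)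
Lemma cosh_le x : (expR x + expR (- x)) / 2 <= expR (2 * x ^+ 2).
Proof.
have small (y : R) : `|y| <= 1 -> expR y <= 1 + y + 2 * y ^+ 2.
  rewrite ler_norml => /andP[y1 y2].
  (* From 1 - y / 2 <= exp(- y / 2), squared, the claim reduces to the polynomial inequality 1 <= (1
     - y / 2)^2 (1 + y + 2 y^2). *)
  have e0 := expR_gt0 (- (y / 2)).
  have e1 := expR_ge1Dx (- (y / 2)).
  have e2 : expR (- (y / 2)) ^+ 2 * expR y = 1.
    by rewrite expr2 -!expRD -[RHS]expR0; congr expR; field.
  have yy : 1 <= (1 - y / 2) ^+ 2 * (1 + y + 2 * y ^+ 2).
    rewrite -subr_ge0.
    have -> : (1 - y / 2) ^+ 2 * (1 + y + 2 * y ^+ 2) - 1 =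
      y ^+ 2 * (1 - y) * (5 / 4 - y / 2) by field.
    apply: mulr_ge0; [apply: mulr_ge0; [exact: sqr_ge0|]|]; lra.
  have e3 : (1 - y / 2) ^+ 2 <= expR (- (y / 2)) ^+ 2.
    have y0 : 0 <= 1 - y / 2 by lra.
    by apply: lerXn2r; rewrite ?nnegrE ?expR_ge0.
  have q0 : 0 <= 1 + y + 2 * y ^+ 2.
    have := sqr_ge0 (y + 1 / 4); nra.
  have e20 : 0 < expR (- (y / 2)) ^+ 2 by rewrite exprn_gt0.
  rewrite -(ler_pM2l e20) e2.
  by apply: (le_trans yy); rewrite ler_wpM2r.
have [x1|x1] := leP `|x| 1.
  apply: (@le_trans _ _ (1 + 2 * x ^+ 2)); last exact: expR_ge1Dx.
  have := small x x1; have := small (- x); rewrite normrN sqrrN => /(_ x1); lra.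
have xx : `|x| <= 2 * x ^+ 2 by rewrite -real_normK ?num_real//; nra.
rewrite ler_pdivrMr// mulr_natr mulr2n lerD// ler_expR; apply: le_trans xx.
  exact: ler_norm.
by rewrite -normrN ler_norm.
Qed.

Section bits.
Variable m : nat.
Local Notation E := {ffun 'I_m -> bool}.

Definition bit_sg (b : 'I_m) (e : E) : R := if e b then 1 else -1.
Definition bit_sum (e : E) : R := \sum_b bit_sg b e.
Definition flip_bit (b : 'I_m) (e : E) : E :=
  [ffun b' => if b' == b then ~~ e b' else e b'].
Definition weight (e : E) : nat := \sum_b e b.

Lemma card_bits : #|E| = (2 ^ m)%N.
Proof. by rewrite card_ffun card_bool card_ord. Qed.

Lemma card_bits_neq0 : #|E|%:R != 0 :> R.
Proof. by rewrite card_bits natrX expf_neq0// pnatr_eq0. Qed.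

Lemma mean_bits_cst (k : R) : mean (fun _ : E => k) = k.
Proof. by rewrite /mean sumr_const -[X in X / _]mulr_natr mulfK// card_bits_neq0. Qed.

Lemma flip_bitK b : involutive (flip_bit b).
Proof. by move=> e; apply/ffunP => b'; rewrite !ffunE; case: eqP => //= _; rewrite negbK. Qed.

Lemma bit_sg_flip b e : bit_sg b (flip_bit b e) = - bit_sg b e.
Proof. by rewrite /bit_sg ffunE eqxx; case: (e b); rewrite ?opprK. Qed.

Lemma bit_sg_flipN b b' e : b != b' -> bit_sg b' (flip_bit b e) = bit_sg b' e.
Proof. by move=> bb; rewrite /bit_sg ffunE eq_sym (negPf bb). Qed.

Lemma bit_sg_sqr b e : bit_sg b e ^+ 2 = 1.
Proof. by rewrite /bit_sg; case: (e b); rewrite ?sqrrN expr1n. Qed.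

Lemma bit_sg_inj e e' : (forall b, bit_sg b e = bit_sg b e') -> e = e'.
Proof.
move=> ee; apply/ffunP => b; have := ee b; rewrite /bit_sg.
case: (e b) (e' b) => [] [] // /eqP;
  by rewrite -subr_eq0 ?opprK -?opprD ?oppr_eq0 (pnatr_eq0 _ 2).
Qed.

Lemma weight_flip b (e : E) : e b = false -> weight (flip_bit b e) = (weight e).+1.
Proof.
move=> eb; rewrite /weight (bigD1 b)//= [in RHS](bigD1 b)//= eb ffunE eqxx eb add0n.
by congr (_.+1); apply: eq_bigr => b' bb'; rewrite ffunE (negPf bb').
Qed.

Lemma weight_le e : (weight e <= m)%N.
Proof.
rewrite /weight -[leqRHS]card_ord -sum1_card; apply: leq_sum => b _.
exact: leq_b1.
Qed.

Lemma weight_surj k : (k <= m)%N -> exists e, weight e = k.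
Proof.
move=> km; exists [ffun b : 'I_m => (b < k)%N].
rewrite /weight; under eq_bigr do rewrite ffunE.
rewrite -(big_mkord predT (fun i => nat_of_bool (i < k)%N)) (@big_cat_nat _ _ _ k)//=.
rewrite (eq_big_nat _ _ (F2 := fun=> 1%N)); last by move=> i /andP[_ ->].
rewrite [X in (_ + X)%N](eq_big_nat _ _ (F2 := fun=> 0%N)); last first.
  by move=> i /andP[ki _]; rewrite ltnNge ki.
by rewrite big1_eq addn0 sum_nat_const_nat muln1 subn0.
Qed.

(** The exponential of the sum is a product over independent bits, so its mean is a power of a
    hyperbolic cosine. *)
Lemma mean_exp_bit_sum (l : R) :
  mean (fun e => expR (l * bit_sum e)) <= expR (2 * l ^+ 2 *+ m).
Proof.
rewrite /mean (eq_bigr (fun e : E => \prod_b expR (l * (if e b then 1 else -1)))); last first.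
  by move=> e _; rewrite mulr_sumr expR_sum.
rewrite -(bigA_distr_bigA (fun (_ : 'I_m) (c : bool) => expR (l * (if c then 1 else -1))))/=.
rewrite prodr_const card_ord big_bool/= mulr1 mulrN1 card_bits natrX -exprVn -exprMn.
rewrite -(mulr_natr (2 * l ^+ 2) m) expRM_natr; apply: lerXn2r; rewrite ?nnegrE ?expR_ge0//.
exact: cosh_le.
Qed.

Lemma mean_bit_sum : mean bit_sum = 0.
Proof.
rewrite mean_sum big1// => b _.
exact: (mean_flip_odd flip_bitK (bit_sg_flip b)).
Qed.

(* Donsker-Varadhan: [x - t <= exp (x - t) - 1], integrated against h *)
Lemma mean_bit_sum_mul_le (l t : R) (s : R) (h : E -> R) : s ^+ 2 = 1 ->
  (forall e, 0 <= h e <= 1) ->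
  l * mean (fun e => s * bit_sum e * h e) <=
  expR (2 * l ^+ 2 *+ m - t) + t * mean h.
Proof.
move=> s2 h01; rewrite -(meanZ l).
apply: (@le_trans _ _ (mean (fun e => expR (- t) * expR (l * s * bit_sum e) + t * h e))).
  apply: le_mean => e; rewrite -expRD.
  have := expR_ge1Dx (- t + l * s * bit_sum e); have := expR_gt0 (- t + l * s * bit_sum e).
  set X := expR _ => X0 X1.
  have /andP[h0 h1] := h01 e.
  have : (l * s * bit_sum e - t) * h e <= X by nra.
  by rewrite (_ : l * (s * bit_sum e * h e) = l * s * bit_sum e * h e); [lra|ring].
rewrite meanD !meanZ lerD2r [_ - t]addrC expRD ler_wpM2l ?expR_ge0//.
by apply: (le_trans (mean_exp_bit_sum _)); rewrite exprMn s2 mulr1.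
Qed.

End bits.

(** A test function of mean [tail z] correlates with the sum of signs at most like a Gaussian tail
    event, giving order sqrt m (z + 1) [tail z], which is O(sqrt m [phi z]). The sign s serves to
    treat negative thresholds by symmetry. *)
Lemma mean_bit_sum_tail : exists2 C : R, 0 < C &
  forall (m : nat) (s : R) (h : {ffun 'I_m -> bool} -> R) (z : R), (0 < m)%N ->
    s ^+ 2 = 1 -> (forall e, 0 <= h e <= 1) -> 0 <= z -> mean h = tail z ->
    mean (fun e => s * bit_sum e * h e) <= C * Num.sqrt m%:R * normal_pdf 0 1 z.
Proof.
have [C C0 HC] := tail_le R.
have pk := peak_gt0 R.
exists (((normal_peak 1)^-1 + 5 / 2) * C); first by rewrite mulr_gt0// addr_gt0// invr_gt0.
move=> m s h z m0 s2 h01 z0 hz.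
set M := mean _; set rm := Num.sqrt _.
have rm0 : 0 < rm by rewrite sqrtr_gt0 ltr0n.
have rm2 : rm ^+ 2 = m%:R by rewrite sqr_sqrtr.
(* The parameters make the exponent 2 (z + 1)^2 - 5/2 (z + 1)^2 = - (z + 1)^2 / 2, so the
   exponential term is the density at z + 1 up to the factor [normal_peak 1], hence O([tail z]). *)
have := @mean_bit_sum_mul_le m ((z + 1) / rm) (5 / 2 * (z + 1) ^+ 2) s h s2 h01.
rewrite -/M hz (_ : _ - _ = - ((z + 1) ^+ 2 / 2)); last first.
  rewrite -mulr_natr expr_div_n rm2; field.
  by rewrite pnatr_eq0 -lt0n.
have := gauss_pdf_le_tail z0; rewrite gauss_pdfE.
set X := expR _ => pX hM.
have XT : X <= (normal_peak 1)^-1 * tail z by rewrite mulrC ler_pdivlMr// mulrC.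
have t0 := tail_ge0 z.
have zC := HC z z0; have p0 := gauss_pdf_gt0 z.
set ip := (normal_peak 1)^-1 in XT *.
have ip0 : 0 < ip by rewrite invr_gt0.
have key : (z + 1) * M <= (ip + 5 / 2) * (z + 1) ^+ 2 * tail z * rm.
  rewrite -ler_pdivrMr// mulrAC; apply: (le_trans hM).
  have : ip * tail z <= ip * (z + 1) ^+ 2 * tail z.
    have : 0 <= ip * tail z by rewrite mulr_ge0// ltW.
    nra.
  nra.
have key2 : M <= (ip + 5 / 2) * (z + 1) * tail z * rm.
  rewrite -(@ler_pM2l _ (z + 1)); last by lra.
  by apply: (le_trans key); rewrite le_eqVlt; apply/orP; left; apply/eqP; ring.
apply: (le_trans key2).
have -> : (ip + 5 / 2) * C * rm * normal_pdf 0 1 z =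
  (ip + 5 / 2) * (C * normal_pdf 0 1 z) * rm by ring.
have a0 : 0 <= ip + 5 / 2 by lra.
have := ler_wpM2r (ltW rm0) (ler_wpM2l a0 zC); apply: le_trans.
by rewrite le_eqVlt; apply/orP; left; apply/eqP; ring.
Qed.

End subgaussian.

(** * Gaussian cells with binomial masses *)

Section cells.
Context (R : realType) (m : nat).
Local Notation TR := (measurableTypeR R).
Local Notation gamma := (gaussian R).
Local Notation E := {ffun 'I_m -> bool}.

Definition weight_tail k : R := mean (fun e : E => (k <= weight e)%N%:R).

Lemma weight_tail0 : weight_tail 0 = 1.
Proof. exact: mean_bits_cst. Qed.

Lemma weight_tail_gt : weight_tail m.+1 = 0.
Proof.
rewrite /weight_tail -[RHS](mean_bits_cst m); apply: eq_mean => e.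
by rewrite ltnNge weight_le.
Qed.

Lemma weight_tailB k : weight_tail k - weight_tail k.+1 =
  mean (fun e : E => (weight e == k)%:R).
Proof.
rewrite /weight_tail -meanN -meanD; apply: eq_mean => e.
by case: ltngtP => _; rewrite ?subrr ?subr0.
Qed.

(** Some word has weight k. This lower bound on the mass of a cell later bounds the density of the
    conditioned law by 2^m. *)
Lemma weight_tailB_ge k : (k <= m)%N ->
  #|E|%:R^-1 <= weight_tail k - weight_tail k.+1.
Proof.
move=> km; rewrite weight_tailB; have [e0 e0k] := weight_surj km.
rewrite /mean -[leLHS]mul1r ler_wpM2r ?invr_ge0//.
by rewrite (bigD1 e0)//= e0k eqxx lerDl sumr_ge0.
Qed.

Lemma weight_tail_itv k : 0 <= weight_tail k <= 1.
Proof.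
apply/andP; split; first by apply: mean_ge0 => e.
rewrite -[leRHS](mean_bits_cst m); apply: le_mean => e.
by case: (_ <= _)%N.
Qed.

Lemma mean_weight (F : nat -> R) : mean (fun e : E => F (weight e)) =
  \sum_(k < m.+1) (weight_tail k - weight_tail k.+1) * F k.
Proof.
transitivity (mean (fun e : E => \sum_(k < m.+1) F k * (weight e == k)%:R)).
  apply: eq_mean => e; have we : (weight e < m.+1)%N by rewrite ltnS weight_le.
  rewrite (bigD1 (Ordinal we))//= eqxx mulr1 big1 ?addr0// => k kw.
  rewrite (_ : weight e == k = false) ?mulr0//; apply/negbTE.
  by apply: contra kw => /eqP kw; apply/eqP/val_inj.
rewrite mean_sum; apply: eq_bigr => k _.
by rewrite meanZ -weight_tailB mulrC.
Qed.

(** Exchanging two bits preserves the weight, so all m bits correlate equally with a function of the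
    weight. *)
Lemma mean_bit_sg_weight b (F : nat -> R) :
  mean (fun e : E => bit_sg R b e * F (weight e)) =
  m%:R^-1 * mean (fun e : E => bit_sum R e * F (weight e)).
Proof.
have m_gt0 : (0 < m)%N by exact: leq_ltn_trans (ltn_ord b).
have sym b' : mean (fun e : E => bit_sg R b' e * F (weight e)) =
    mean (fun e : E => bit_sg R b e * F (weight e)).
  pose h (e : E) : E := [ffun i => e (tperm b b' i)].
  have hK : involutive h by move=> e; apply/ffunP => i; rewrite !ffunE tpermK.
  rewrite -[RHS](@mean_reindex _ _ h); last exact: inv_bij.
  apply: eq_mean => e; congr (_ * F _).
    by rewrite /bit_sg ffunE tpermL.
  rewrite /weight (reindex_inj (@perm_inj _ (tperm b b'))).
  by apply: eq_bigr => i _; rewrite ffunE.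
rewrite [in RHS](@eq_mean _ _ _
  (fun e : E => \sum_b' bit_sg R b' e * F (weight e))); last first.
  by move=> e; rewrite mulr_suml.
rewrite mean_sum (eq_bigr _ (fun b' _ => sym b')) sumr_const card_ord.
by rewrite -[X in _ * X]mulr_natl mulKf// pnatr_eq0 -lt0n.
Qed.

(** Quantiles exist only for 0 < p < 1; the extreme cases are pinned to the empty set and the whole
    line, so that the cells cover the line exactly. *)
Lemma upper_ray (p : R) : 0 <= p <= 1 -> exists L : set TR,
  [/\ measurable L, gamma L = p%:E, (forall x y : R, L x -> x <= y -> L y),
     (p = 0 -> L = set0) & (p = 1 -> L = setT)].
Proof.
move=> /andP[p0 p1].
have [->|p_neq0] := eqVneq p 0.
  exists set0; split=> //; first by rewrite measure0.
  by move/eqP; rewrite eq_sym oner_eq0.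
have [->|p_neq1] := eqVneq p 1.
  exists setT; split=> //; first exact: probability_setT.
  by move/eqP; rewrite oner_eq0.
have [|z zp] := @tail_quantile R p.
  by rewrite !lt_neqAle eq_sym p_neq0 p0 p_neq1 p1.
exists `]z, +oo[%classic; split=> //.
- by rewrite tailE zp.
- by move=> x y /=; rewrite !in_itv/= !andbT; exact: lt_le_trans.
- by move=> p_eq0; rewrite p_eq0 eqxx in p_neq0.
- by move=> p_eq1; rewrite p_eq1 eqxx in p_neq1.
Qed.

Lemma weight_rays : exists L : nat -> set TR, forall k,
  [/\ measurable (L k), gamma (L k) = (weight_tail k)%:E,
      (forall x y : R, L k x -> x <= y -> L k y),
      (weight_tail k = 0 -> L k = set0) & (weight_tail k = 1 -> L k = setT)].
Proof.
by have [L HL] := choice (fun k => upper_ray (weight_tail_itv k)); exists L.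
Qed.

(** The cell J k is the difference of consecutive rays and [kappa k] is the Gaussian law conditioned
    on it. Weighted by the cell masses, the conditioned laws telescope to the Gaussian. A threshold
    z cannot cut two consecutive cells. *)
Lemma weight_cells : exists kappa : nat -> probability TR R,
  [/\ (forall S, measurable S -> emean (fun e : E => kappa (weight e) S) = gamma S),
      (forall k (z : R), (k < m)%N ->
         fine (kappa k `]z, +oo[%classic) = 0 \/ fine (kappa k.+1 `]z, +oo[%classic) = 1) &
      (forall k S, (k <= m)%N -> measurable S ->
         (kappa k S <= #|E|%:R%:E * gamma S)%E)].
Proof.
have [L HL] := weight_rays.
have mL k : measurable (L k) by case: (HL k).
have gL k : gamma (L k) = (weight_tail k)%:E by case: (HL k).
have upL k x y : L k x -> x <= y -> L k y by case: (HL k) => _ _ + _ _; exact.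
have L0 : L 0%N = setT by case: (HL 0%N) => _ _ _ _; apply; exact: weight_tail0.
have Lm : L m.+1 = set0 by case: (HL m.+1) => _ _ _ + _; apply; exact: weight_tail_gt.
have pi_gt0 k : (k <= m)%N -> 0 < weight_tail k - weight_tail k.+1.
  move=> km; apply: lt_le_trans (weight_tailB_ge km).
  by rewrite invr_gt0 lt_neqAle eq_sym card_bits_neq0/=.
(* Two upward closed sets are comparable, and the strict order of their masses decides the
   inclusion. *)
have Lsub k : (k <= m)%N -> L k.+1 `<=` L k.
  move=> km x Lx; apply: contrapT => nLx.
  have sub : L k `<=` L k.+1.
    move=> y Ly; apply: (upL _ x) => //; rewrite leNgt; apply/negP => yx.
    by apply: nLx; apply: (upL _ y) => //; exact: ltW.
  have : (gamma (L k) <= gamma (L k.+1))%E by apply: le_measure; rewrite ?inE.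
  by rewrite !gL lee_fin leNgt -subr_gt0 pi_gt0.
pose J k := L k `\` L k.+1.
have mJ k : measurable (J k) by exact: measurableD.
have gJ k S : (k <= m)%N -> measurable S ->
    gamma (S `&` J k) = (gamma (S `&` L k) - gamma (S `&` L k.+1))%E.
  move=> km mS; rewrite /J setIDA.
  have -> : S `&` L k `\` L k.+1 = (S `&` L k) `\` (S `&` L k.+1).
    apply/seteqP; split=> x.
      by move=> [[Sx Lx] nLx]; split => // -[_].
    by move=> [[Sx Lx] nLx]; split => // Lx'; apply: nLx.
  have sub : S `&` L k.+1 `<=` S `&` L k by apply: setIS; exact: Lsub.
  rewrite measureD//; [|exact: measurableI|exact: measurableI|]; last first.
    by rewrite -ge0_fin_numE// fin_num_measure//; exact: measurableI.
  by rewrite (setIidr sub).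
(* The last argument is the fallback for a null restriction; for k <= m the cell has positive
   mass. *)
pose kappa k : probability TR R := mnormalize (mrestr gamma (mJ k)) gamma.
have kappaE k S : (k <= m)%N -> measurable S ->
    kappa k S = (gamma (S `&` J k) * ((weight_tail k - weight_tail k.+1)^-1)%:E)%E.
  move=> km mS.
  have JT : gamma (setT `&` J k) = (weight_tail k - weight_tail k.+1)%:E.
    by rewrite gJ// !setTI !gL EFinB.
  rewrite /kappa/= /mnormalize/= /mrestr JT.
  rewrite eqe (gt_eqF (pi_gt0 k km))/=.
  by [].
exists kappa; split.
- move=> S mS.
  have mSL k : measurable (S `&` L k) by exact: measurableI.
  transitivity (emean (fun e : E => (fine (kappa (weight e) S))%:E)).
    by apply: eq_emean => e; rewrite fineK// fin_num_measure.
  rewrite -EFin_mean (mean_weight (fun k => fine (kappa k S))).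
  pose f k := - fine (gamma (S `&` L k)).
  rewrite (eq_bigr (fun k : 'I_m.+1 => f k.+1 - f k)).
    rewrite -(big_mkord predT (fun k => f k.+1 - f k)) telescope_sumr//.
    by rewrite /f L0 Lm setIT setI0 measure0 oppr0 sub0r opprK fineK// fin_num_measure.
  move=> k _; have km : (k <= m)%N by rewrite -ltnS.
  rewrite kappaE// gJ// fineM//; last by rewrite fin_numB !fin_num_measure.
  rewrite fineB ?fin_num_measure// mulrCA mulfV ?mulr1; last by rewrite gt_eqF// pi_gt0.
  by rewrite /f opprK addrC.
- move=> k z km.
  (* If z is in [L k.+1], all points above z are too and miss cell k; otherwise all of [L k.+1],
     hence cell k + 1, lies above z. *)
  have [Lz|nLz] := pselect (L k.+1 z); [left|right].
    rewrite kappaE ?(ltnW km)// (_ : _ `&` _ = set0) ?measure0 ?mul0e//.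
    apply/seteqP; split=> // x [/=]; rewrite in_itv/= andbT => zx [_]; apply.
    by apply: (upL _ z) => //; exact: ltW.
  rewrite kappaE// (_ : _ `&` _ = setT `&` J k.+1).
    rewrite gJ// !setTI !gL -EFinB -EFinM divff//.
    by rewrite gt_eqF// pi_gt0.
  apply/seteqP; split=> x [_ Jx]; split=> //=; rewrite in_itv/= andbT ltNge.
  by apply/negP => xz; apply: nLz; apply: (upL _ x) => //; case: Jx.
- move=> k S km mS; rewrite kappaE// muleC.
  apply: lee_pmul => //; first by rewrite lee_fin invr_ge0 ltW// pi_gt0.
    rewrite lee_fin -[leRHS]invrK lef_pV2 ?posrE ?pi_gt0//; first exact: weight_tailB_ge.
    by rewrite invr_gt0 lt_neqAle eq_sym card_bits_neq0/=.
  by apply: le_measure; rewrite ?inE//; exact: measurableI.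
Qed.

End cells.

(** * Bit flips and the Minkowski content *)

Section gaussian_bits.
Context (R : realType).
Local Notation TR := (measurableTypeR R).
Local Notation gamma := (gaussian R).
Local Notation content := (lower_minkowski_content gamma).

(** For words differing in one bit, the lower one has no mass above z or the upper one has all of
    it. The crossing mass is then linear, a signed difference of masses above z, and averages to 2 /
    m times the correlation with the sum of signs. *)
Lemma bit_crossing_bound : exists2 C : R, 0 < C & forall m, (0 < m)%N ->
  exists kappa : {ffun 'I_m -> bool} -> probability TR R,
  [/\ (forall S, measurable S -> emean (kappa^~ S) = gamma S),
      (forall e S, measurable S -> (kappa e S <= (2 ^ m)%:R%:E * gamma S)%E),
      (forall b z, mean (fun e => crossing (kappa e) (kappa (flip_bit b e)) z) <=
         C / Num.sqrt m%:R * normal_pdf 0 1 z) &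
      (forall z, mean (fun e => crossing (kappa e) (kappa e) z) <=
         2 * (C / Num.sqrt m%:R) * normal_pdf 0 1 z)].
Proof.
have [C C0 HC] := mean_bit_sum_tail R.
exists (2 * C); first by rewrite mulr_gt0.
move=> m m0.
have [kw [kw_mean kw_step kw_le]] := weight_cells R m.
pose kappa (e : {ffun 'I_m -> bool}) := kw (weight e).
have kappa_le e S : measurable S -> (kappa e S <= (2 ^ m)%:R%:E * gamma S)%E.
  by move=> mS; rewrite -card_bits; apply: kw_le => //; exact: weight_le.
pose H z e := fine (kappa e `]z, +oo[%classic).
have H01 z e : 0 <= H z e <= 1 by exact: fine_prob_itv.
have H_le z e : fine (kappa e `]-oo, z]%classic) = 1 - H z e.
  by rewrite -fine_probC// setCitvr.
have H_ge z e : fine (kappa e `[z, +oo[%classic) = H z e.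
  have k1 : kappa e [set z] = 0%E.
    apply/eqP; rewrite eq_le measure_ge0 andbT.
    by have := @kappa_le e [set z] (measurable_set1 z); rewrite gaussian_set1 mule0.
  rewrite /H -(@setU1itv _ _ _ _ false)// measureU//; last first.
    by apply/seteqP; split=> // x [/= ->]; rewrite in_itv/= ltxx.
  by congr fine; rewrite -[RHS]add0e; congr (_ + _)%E; exact: k1.
have crossE z e e' : crossing (kappa e) (kappa e') z =
    (1 - H z e) * H z e' + H z e * (1 - H z e').
  by rewrite /crossing !H_le !H_ge.
have step z b (e : {ffun 'I_m -> bool}) : e b = false -> H z e = 0 \/ H z (flip_bit b e) = 1.
  move=> eb; rewrite /H /kappa (weight_flip eb).
  by apply: kw_step; rewrite -(weight_flip eb) weight_le.
have cross_flip z b e : crossing (kappa e) (kappa (flip_bit b e)) z =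
    bit_sg R b e * (H z e - H z (flip_bit b e)).
  rewrite crossE /bit_sg; case: (boolP (e b)) => [eb|/negbTE eb].
    have feb : flip_bit b e b = false by rewrite ffunE eqxx eb.
    have := step z _ _ feb; rewrite flip_bitK => -[->|->]; ring.
  by have [->|->] := step z _ _ eb; ring.
have cross_diag z b e : crossing (kappa e) (kappa e) z <=
    2 * crossing (kappa e) (kappa (flip_bit b e)) z.
  rewrite !crossE; have /andP[h0 h1] := H01 z e; have /andP[g0 g1] := H01 z (flip_bit b e).
  case: (boolP (e b)) => [eb|/negbTE eb].
    have feb : flip_bit b e b = false by rewrite ffunE eqxx eb.
    have := step z _ _ feb; rewrite flip_bitK => -[->|->]; nra.
  by have [->|->] := step z _ _ eb; nra.
have Hmean z : mean (H z) = tail z.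
  apply: EFin_inj; rewrite EFin_mean -tailE -kw_mean//.
  by apply: eq_emean => e; rewrite fineK// fin_num_measure.
(* For negative z the tail estimate is applied to 1 - H with the opposite sign; this changes nothing
   because the sum of signs has mean 0. *)
have sumH z : mean (fun e => bit_sum R e * H z e) <=
    C * Num.sqrt m%:R * normal_pdf 0 1 z.
  have [z0|/ltW z0] := leP 0 z.
    have := HC m 1 (H z) z m0 (expr1n _ _) (H01 z) z0 (Hmean z).
    by under eq_mean do rewrite mul1r.
  have h01 e : 0 <= 1 - H z e <= 1 by have := H01 z e; lra.
  have hm : mean (fun e => 1 - H z e) = tail (- z).
    by rewrite meanD meanN Hmean mean_bits_cst tailN.
  have := HC m (-1) (fun e => 1 - H z e) (- z) m0 _ h01 _ hm.
  rewrite sqrrN expr1n oppr_ge0 gauss_pdfN => /(_ erefl z0); apply: le_trans.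
  rewrite (@eq_mean _ _ (fun e => -1 * bit_sum R e * (1 - H z e))
    (fun e => - bit_sum R e + bit_sum R e * H z e)); last by move=> e; ring.
  by rewrite meanD meanN mean_bit_sum oppr0 add0r.
have rm0 : 0 < Num.sqrt (m%:R : R) by rewrite sqrtr_gt0 ltr0n.
have flip_bound b z : mean (fun e => crossing (kappa e) (kappa (flip_bit b e)) z) <=
    2 * C / Num.sqrt m%:R * normal_pdf 0 1 z.
  rewrite (@eq_mean _ _ _ (fun e =>
      bit_sg R b e * H z e + - (bit_sg R b e * H z (flip_bit b e)))).
    rewrite meanD meanN.
    (* Reindexing by the flip negates the sign, so the two terms of the difference contribute
       equally. *)
    have -> : mean (fun e => bit_sg R b e * H z (flip_bit b e)) =
        - mean (fun e => bit_sg R b e * H z e).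
      rewrite -(@mean_reindex _ _ (flip_bit b)); last exact/inv_bij/flip_bitK.
      by rewrite -meanN; apply: eq_mean => e; rewrite flip_bitK bit_sg_flip mulNr.
    rewrite opprK (mean_bit_sg_weight b (fun k => fine (kw k `]z, +oo[%classic))).
    have := sumH z; rewrite /H /kappa.
    set M := mean _; set ph := normal_pdf _ _ _ => MC.
    have m2 : Num.sqrt (m%:R : R) ^+ 2 = m%:R by rewrite sqr_sqrtr.
    set r := Num.sqrt _ in rm0 MC m2 *; rewrite -m2.
    have -> : (r ^+ 2)^-1 * M + (r ^+ 2)^-1 * M = 2 / r ^+ 2 * M by ring.
    rewrite [leRHS](_ : _ = 2 / r ^+ 2 * (C * r * ph)); last by field; rewrite gt_eqF.
    by rewrite ler_wpM2l// divr_ge0// exprn_ge0// ltW.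
  by move=> e; rewrite cross_flip mulrBr.
exists kappa; split => // z.
apply: (@le_trans _ _ (mean (fun e =>
    2 * crossing (kappa e) (kappa (flip_bit (Ordinal m0) e)) z))).
  by apply: le_mean => e; exact: cross_diag.
by rewrite meanZ -[leRHS]mulrA ler_wpM2l.
Qed.

(** Both bounds come from [mean_crossing_content], and both need the factor 4 C: the diagonal one
    since its crossing mass is doubled, the flip one since |p - q| <= p (1 - q) + q (1 - p) has two
    terms. *)
Lemma bit_content_bound : exists2 D : R, 0 < D & forall m, (0 < m)%N ->
  exists kappa : {ffun 'I_m -> bool} -> probability TR R,
  [/\ (forall S, measurable S -> emean (kappa^~ S) = gamma S),
      (forall S, measurable S ->
         ((mean_bvar kappa S / (D / Num.sqrt m%:R))%:E <= content S)%E) &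
      (forall b S, measurable S ->
         ((mean_bdist kappa (flip_bit b) S / (D / Num.sqrt m%:R))%:E <= content S)%E)].
Proof.
have [C C0 HC] := bit_crossing_bound.
exists (4 * C); first by rewrite mulr_gt0.
move=> m m0; have [kappa [kmean kle kflip kdiag]] := HC m m0.
have rm0 : 0 < Num.sqrt (m%:R : R) by rewrite sqrtr_gt0 ltr0n.
have k0 : 0 < C / Num.sqrt (m%:R : R) by rewrite divr_gt0.
have K0 : 0 < (2 ^ m)%:R :> R by rewrite ltr0n expn_gt0.
exists kappa; split => // [S mS|b S mS].
- have := mean_crossing_content (mulr_gt0 (ltr0Sn R 1) k0) K0 mS kdiag kle.
  apply: le_trans; rewrite lee_fin le_eqVlt; apply/orP; left; apply/eqP.
  congr (_ / _); last by ring.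
  by apply: eq_mean => e; rewrite /bvar fine_probC.
- have := mean_crossing_content k0 K0 mS (kflip b) (fun e => kle _).
  apply: le_trans; rewrite lee_fin.
  set M := mean _.
  have -> : M / (2 * (C / Num.sqrt m%:R)) = (2 * M) / (4 * C / Num.sqrt m%:R).
    by field; rewrite !gt_eqF.
  rewrite ler_wpM2r ?invr_ge0 ?divr_ge0 ?mulr_ge0 ?(ltW C0)//.
  (* The flip exchanges the two terms, so they have the same mean M. *)
  have -> : 2 * M = mean (fun e => fine (kappa e S) * fine (kappa (flip_bit b e) (~` S)) +
      fine (kappa (flip_bit b e) S) * fine (kappa e (~` S))).
    rewrite meanD mulr_natl mulr2n; congr (_ + _).
    rewrite /M -(@mean_reindex _ _ (flip_bit b)); last exact/inv_bij/flip_bitK.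
    by apply: eq_mean => e; rewrite flip_bitK.
  apply: le_mean => e; rewrite !fine_probC//.
  have /andP[h0 h1] := fine_prob_itv (kappa e) mS.
  have /andP[g0 g1] := fine_prob_itv (kappa (flip_bit b e)) mS.
  by rewrite ler_norml; apply/andP; split; nra.
Qed.

End gaussian_bits.

(** * The theorem *)

Section influences.
Context (R : realType).
Local Notation TR := (measurableTypeR R).
Local Notation gamma := (gaussian R).
Local Notation content := (lower_minkowski_content gamma).

Lemma content_ge0 (S : set R) : measurable (S : set TR) -> (0 <= content S)%E.
Proof.
move=> mS; have := @content_ge R S 0 1 1 mS (lexx 0) ltr01 ltr01.
rewrite mul0r; apply => r r0 _; rewrite mulr0 mul1e.
exact: measure_ge0.
Qed.

(** Used with v the averaged variance or the averaged flip distance. Only v is known to be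
    measurable along the fibers, so the content is compared through the supremum over simple
    functions. *)
Lemma influence_ge n (A : set (n.-tuple TR)) (i : 'I_n) (v : set R -> R) (k : R) :
  0 < k -> measurable A ->
  measurable_fun setT (fun x => v (fiber A i x)) ->
  (forall S, measurable (S : set TR) -> 0 <= v S) ->
  (forall S, measurable (S : set TR) -> ((v S / k)%:E <= content S)%E) ->
  (\int[power_prob gamma n]_x (v (fiber A i x))%:E <=
    k%:E * geometric_influence gamma A i)%E.
Proof.
move=> k0 mA mv v0 vk.
have mF x : measurable (fiber A i x : set TR) by exact: measurable_fiber.
rewrite -lee_pdivrMl// -ge0_integralZl; [|exact: measurableT| | |]; last 3 first.
- exact/measurable_EFinP.
- by move=> x _; rewrite lee_fin v0.
- by rewrite lee_fin invr_ge0 ltW.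
apply: le_integral_nonmeasurable => x.
  by rewrite -EFinM lee_fin; apply: mulr_ge0; [rewrite invr_ge0 ltW|exact: v0].
by rewrite -EFinM mulrC vk.
Qed.

Lemma influence_ge0 n (A : set (n.-tuple TR)) (i : 'I_n) : measurable A ->
  (0 <= geometric_influence gamma A i)%E.
Proof.
by move=> mA; apply: integral_ge0 => x _; apply: content_ge0; exact: measurable_fiber.
Qed.

Lemma ln_le_trunc_log n : (1 < n)%N -> ln (n%:R : R) <= 2 * (trunc_log 2 n)%:R.
Proof.
move=> n1; set l := trunc_log 2 n.
have l1 : (0 < l)%N by rewrite trunc_log_gt0.
have n2 : (n%:R : R) <= 2 ^+ l.+1.
  by rewrite -natrX ler_nat ltnW// trunc_log_ltn.
have n0 : 0 < (n%:R : R) by rewrite ltr0n ltnW.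
apply: (@le_trans _ _ (ln (2 ^+ l.+1))); first by rewrite ler_ln ?posrE ?exprn_gt0.
have ln2 : ln (2 : R) <= 1 by apply: (@le_ln1Dx R 1); lra.
have l1R : (1 : R) <= l%:R by rewrite ler1n.
rewrite lnXn// -(mulr_natr (ln _) l.+1) -(addn1 l) natrD; nra.
Qed.

Lemma leq_mul_divS l : (l <= 8 * (l %/ 8).+1)%N.
Proof. lia. Qed.

(** With l <= 8 (d + 1) <= 8 2^d and 3^d <= 4^d the square is at most 64 2^(6 d), and 6 d <= l. It
    keeps the low-degree term of the variance bound small. *)
Lemma trunc_log_bound n (l := trunc_log 2 n) (d := (l %/ 8)%N) : (0 < n)%N ->
  ((l%:R * 3 ^+ d) ^+ 2 : R) <= 64 * n%:R.
Proof.
move=> n0.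
have h1 : (2 ^ l <= n)%N by exact: trunc_logP.
have h2 : (l <= 8 * 2 ^ d)%N.
  apply: (@leq_trans (8 * d.+1)); last by rewrite leq_mul2l/= ltn_expl.
  exact: leq_mul_divS.
have h3 : (3 ^ d <= 2 ^ (2 * d))%N by rewrite expnM; case: (d) => // d'; rewrite leq_exp2r.
have h4 : ((l * 3 ^ d) ^ 2 <= 64 * n)%N.
  apply: (@leq_trans ((8 * 2 ^ d * 2 ^ (2 * d)) ^ 2)).
    by rewrite leq_exp2r// leq_mul.
  rewrite -mulnA -expnD expnMn -expnM leq_mul2l/=.
  apply: leq_trans h1; rewrite leq_exp2l//.
  rewrite [leqRHS](divn_eq l 8) -/d; lia.
by rewrite -natrX -natrM -natrX -natrM ler_nat.
Qed.

End influences.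

Theorem theorem1p4 (R : realType) :
  exists c : R, 0 < c /\
    forall (n : nat) (A : set (n.-tuple (measurableTypeR R))) (t : R),
      (1 <= n)%N -> measurable A -> power_prob (gaussian R) n A = t%:E ->
      exists i : 'I_n,
        ((c * (t * (1 - t)) * (Num.sqrt (ln n%:R) / n%:R))%:E
          <= geometric_influence (gaussian R) A i)%E.
Proof.
have [D D0 HD] := bit_content_bound R.
(* 128 is 64 times 2: the 2 pays for sqrt (ln n) <= 2 sqrt m, and 64 leaves every bit influence at
   most tau / (64 n). *)
exists (1 / 128 / D); split; first by rewrite !divr_gt0.
move=> n A t n1 mA At.
have /andP[t0 t1] : 0 <= t <= 1.
  by have := fine_prob_itv (power_prob (gaussian R) n) mA; rewrite At.
set tau := t * (1 - t).
have tau_ge0 : 0 <= tau by rewrite mulr_ge0// subr_ge0.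
pose i0 : 'I_n := Ordinal n1.
have [n_gt1|n_le1] := ltnP 1 n; last first.
  have n_eq1 : n = 1%N by apply/eqP; rewrite eqn_leq n_le1.
  exists i0; rewrite (_ : ln n%:R = 0); last by rewrite n_eq1 ln1.
  rewrite sqrtr0 mul0r mulr0; exact: influence_ge0.
have [tau0|tau_neq0] := eqVneq tau 0.
  by exists i0; rewrite tau0 mulr0 mul0r; exact: influence_ge0.
have tau_gt0 : 0 < tau by rewrite lt_neqAle eq_sym tau_neq0.
apply: contrapT => no_i.
set q := 1 / 128 / D * tau * _ in no_i.
have Iq i : (geometric_influence (gaussian R) A i <= q%:E)%E.
  by apply: ltW; rewrite ltNge; apply/negP => iq; apply: no_i; exists i.
(* About log2 n bits per coordinate, so that 1 / sqrt m cancels sqrt (ln n); the cutoff d keeps 3^d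
   below a small power of n. *)
pose m := trunc_log 2 n; pose d := (m %/ 8)%N.
have m0 : (0 < m)%N by rewrite trunc_log_gt0.
have [kappa [kmean kvar kdist]] := HD m m0.
have rm0 : 0 < Num.sqrt (m%:R : R) by rewrite sqrtr_gt0 ltr0n.
set k := D / Num.sqrt m%:R in kvar kdist.
have k0 : 0 < k by rewrite divr_gt0.
have nR0 : 0 < (n%:R : R) by rewrite ltr0n.
pose a : R := tau / 64 / n%:R.
have a0 : 0 <= a by rewrite !divr_ge0// ltW.
have kq : k * q <= a.
  have sq : Num.sqrt (ln (n%:R : R)) <= 2 * Num.sqrt m%:R.
    rewrite -[leRHS]ger0_norm ?mulr_ge0// -sqrtr_sqr ler_wsqrtr//.
    rewrite exprMn sqr_sqrtr//; apply: (le_trans (ln_le_trunc_log R n_gt1)).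
    by rewrite ler_wpM2r// expr2; lra.
  rewrite /k /q /a.
  have -> : D / Num.sqrt m%:R * (1 / 128 / D * tau * (Num.sqrt (ln n%:R) / n%:R)) =
     tau / 128 / n%:R / Num.sqrt m%:R * Num.sqrt (ln n%:R).
    by field; rewrite !gt_eqF.
  have -> : tau / 64 / n%:R = tau / 128 / n%:R / Num.sqrt m%:R * (2 * Num.sqrt m%:R).
    by field; rewrite !gt_eqF.
  by rewrite ler_wpM2l// !divr_ge0// ltW.
pose f e := fine (prod_prob kappa (n := n) e A).
have f01 e : 0 <= f e <= 1 by exact: fine_prob_itv.
have fvar : mean (fun e => f e * (1 - f e)) <= tau / 64.
  rewrite -lee_fin; apply: (le_trans (mean_bvar_prod_prob kmean mA)).
  apply: (@le_trans _ _ (\sum_(i < n) a%:E)%E).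
    apply: lee_sum => i _.
    apply: (le_trans (influence_ge k0 mA _ _ kvar)).
    - by apply: measurable_mean => e; exact: measurable_bvar_fiber.
    - by move=> S mS; apply: mean_ge0 => e; exact: bvar_ge0.
    apply: (@le_trans _ _ (k%:E * q%:E)%E); last by rewrite -EFinM lee_fin.
    by apply: lee_wpmul2l => //; rewrite lee_fin ltW.
  by rewrite sumEFin lee_fin sumr_const card_ord -(mulr_natr a n) /a divfK// gt_eqF.
have fdist i b : mean (fun e => `|f e - f (upd i (flip_bit b) e)|) <= a.
  rewrite -lee_fin; apply: (le_trans (mean_dist_prod_prob kmean i (flip_bit b) mA)).
  apply: (le_trans (influence_ge k0 mA _ _ (kdist b))).
  - apply: measurable_mean => e; apply: measurableT_comp => //.
    by apply: measurable_funB; exact: measurable_prob_fiber.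
  - by move=> S mS; exact: mean_ge0.
  apply: (@le_trans _ _ (k%:E * q%:E)%E); last by rewrite -EFinM lee_fin.
  by apply: lee_wpmul2l => //; rewrite lee_fin ltW.
have fmean : mean f = t.
  apply: EFin_inj; rewrite EFin_mean -At -(prod_prob_mean kmean mA).
  by apply: eq_emean => e; rewrite fineK// fin_num_measure.
(* The words form a cube whose bits are indexed by pairs of a coordinate and a bit of that
   coordinate. *)
pose X : finType := n.-tuple {ffun 'I_m -> bool}.
pose I : finType := ('I_n * 'I_m)%type.
pose flip (p : I) (e : X) : X := upd p.1 (flip_bit p.2) e.
pose sg (p : I) (e : X) : R := bit_sg R p.2 (tnth e p.1).
have flipK p : involutive (flip p).
  move=> e; apply: eq_from_tnth => j; rewrite !tnth_mktuple.
  by case: eqP => // _; rewrite flip_bitK.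
have sg_sqr p e : sg p e ^+ 2 = 1 by exact: bit_sg_sqr.
have sg_flip p e : sg p (flip p e) = - sg p e.
  by rewrite /sg tnth_mktuple eqxx bit_sg_flip.
have sg_flipN p p' e : p != p' -> sg p' (flip p e) = sg p' e.
  move=> pp'; rewrite /sg tnth_mktuple; case: eqP => // ii.
  rewrite bit_sg_flipN//; apply: contra pp' => /eqP bb.
  by apply/eqP; case: p p' ii bb => [? ?] [? ?] /= -> ->.
have sg_inj e e' : (forall p, sg p e = sg p e') -> e = e'.
  move=> ee; apply: eq_from_tnth => j; apply: (@bit_sg_inj R) => b.
  exact: (ee (j, b)).
have cardX : #|X| = (2 ^ #|I|)%N.
  by rewrite card_tuple card_bits card_prod !card_ord -expnM mulnC.
have s2 : Num.sqrt a ^+ 2 = a by rewrite sqr_sqrtr.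
have := @variance_le_influences R X I flip sg flipK sg_sqr sg_flip sg_flipN sg_inj
  cardX f d (Num.sqrt a) (sqrtr_ge0 a) f01.
rewrite s2 fmean => /(_ (fun p => fdist p.1 p.2)).
have mE : mean (fun e => f e * (1 - f e)) = t - mean (fun e => f e ^+ 2).
  by rewrite -fmean -meanN -meanD; apply: eq_mean => e; ring.
rewrite mE in fvar.
have -> : #|I|%:R = n%:R * m%:R :> R by rewrite card_prod !card_ord natrM.
set s := Num.sqrt a in s2 *.
have s0 : 0 <= s by exact: sqrtr_ge0.
(* High levels: n m a / (d + 1) is tau / 64 times m / (d + 1), and m <= 8 (d + 1). *)
have part1 : n%:R * m%:R * (a / d.+1%:R) <= tau / 8.
  have -> : n%:R * m%:R * (a / d.+1%:R) = tau / 64 * (m%:R / d.+1%:R).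
    by rewrite /a; field; rewrite !gt_eqF// ltr0n.
  rewrite (_ : tau / 8 = tau / 64 * 8); last by field.
  rewrite ler_wpM2l ?divr_ge0// ler_pdivrMr ?ltr0n// -natrM ler_nat.
  exact: leq_mul_divS.
(* Low levels: the square of m 3^d s is at most 64 n a = tau <= 1. *)
have part2 : n%:R * m%:R * (3 ^+ d * s ^+ 3) <= tau / 64.
  have -> : n%:R * m%:R * (3 ^+ d * s ^+ 3) = tau / 64 * (m%:R * 3 ^+ d * s).
    rewrite exprS s2 /a; field; rewrite gt_eqF//.
  rewrite -[leRHS]mulr1 ler_wpM2l ?divr_ge0//.
  have w0 : 0 <= m%:R * 3 ^+ d * s by rewrite !mulr_ge0// exprn_ge0.
  rewrite -(@ler_pXn2r _ 2)// ?nnegrE// expr1n exprMn s2.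
  apply: (@le_trans _ _ (64 * n%:R * a)).
    by rewrite ler_wpM2r//; exact: trunc_log_bound.
  rewrite /a (_ : 64 * n%:R * (tau / 64 / n%:R) = tau); last by field; rewrite gt_eqF.
  by rewrite /tau; nra.
rewrite mulrDr => var.
have {}var : mean (fun e => f e ^+ 2) - t ^+ 2 <= tau / 8 + tau / 64.
  exact: (le_trans var (lerD part1 part2)).
(* The variance of f and the mean of f (1 - f) add up to tau, but are bounded by tau / 8 + tau / 64
   and tau / 64. *)
have tauE : tau = t - t ^+ 2 by rewrite /tau; ring.
lra.
Qed.
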